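(* Let $\mathcal{C}$ be a near-integral fusion category, with distinguished fusion subcategory $\mathcal{D}$, distinguished simple object $\rho$, $N:=\mathrm{FPdim}(\mathcal{D})$ and $\kappa:=\dim_{\mathbb{C}}\mathrm{Hom}_{\mathcal{C}}(\rho,\rho\otimes\rho)$. If $\mathrm{FPdim}(\mathcal{C})$ is irrational, then $N\mid\kappa$.
   Context: Fusion categories are over $\mathbb{C}$; $\mathrm{FPdim}$ denotes Frobenius-Perron dimension (of objects and of categories), and rank is the number of isomorphism classes of simple objects. A fusion category $\mathcal{C}$ is near-integral if it has a fusion subcategory $\mathcal{D}\subset\mathcal{C}$ with $\mathrm{rank}(\mathcal{D})+1=\mathrm{rank}(\mathcal{C})$; $\rho$ denotes the unique (up to isomorphism) simple object of $\mathcal{C}$ not in $\mathcal{D}$. (Every simple object of $\mathcal{D}$ then has integer Frobenius-Perron dimension, so $N\in\mathbb{Z}_{\geq 1}$.) *)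

(* Defs.v *)
(* The complex numbers are R[i], for an arbitrary [R : realType]. *)
From HB Require Import structures.
From mathcomp Require Import all_boot all_order all_algebra.
From mathcomp Require Import complex.
From mathcomp Require Import boolp classical_sets reals.

Set Implicit Arguments.
Unset Strict Implicit.
Unset Printing Implicit Defensive.

Import Order.TTheory GRing.Theory Num.Theory.
Local Open Scope ring_scope.
Local Open Scope complex_scope.

Declare Scope cat_scope.
Delimit Scope cat_scope with cat.

(* [vectType] makes every Hom space finite dimensional. *)
Record linear_category (R : realType) := LinearCategory {
  obj :> Type;
  mor : obj -> obj -> vectType R[i];
  idm : forall X, mor X X;
  compm : forall X Y Z, mor Y Z -> mor X Y -> mor X Z;
  comp1m : forall X Y (f : mor X Y), compm (idm Y) f = f;
  compm1 : forall X Y (f : mor X Y), compm f (idm X) = f;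
  compA : forall W X Y Z (h : mor Y Z) (g : mor X Y) (f : mor W X),
    compm h (compm g f) = compm (compm h g) f;
  comp_linearl : forall X Y Z (f : mor X Y) (a : R[i]) (g h : mor Y Z),
    compm (a *: g + h) f = a *: compm g f + compm h f;
  comp_linearr : forall X Y Z (h : mor Y Z) (a : R[i]) (f g : mor X Y),
    compm h (a *: f + g) = a *: compm h f + compm h g;
}.

Arguments mor {R l} X Y : rename.
Arguments idm {R l} X : rename.
Arguments compm {R l X Y Z} g f : rename.

Notation "g \oc f" := (compm g f) (at level 50, left associativity) : cat_scope.
Local Open Scope cat_scope.

Section LinearCategoryNotions.
Variables (R : realType) (C : linear_category R).

Definition is_iso (X Y : C) (f : mor X Y) : Prop :=
  exists g : mor Y X, g \oc f = idm X /\ f \oc g = idm Y.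

Definition isomorphic (X Y : C) : Prop := exists f : mor X Y, is_iso f.

Definition mono (X Y : C) (f : mor X Y) : Prop :=
  forall (W : C) (g h : mor W X), f \oc g = f \oc h -> g = h.

Definition epi (X Y : C) (f : mor X Y) : Prop :=
  forall (Z : C) (g h : mor Y Z), g \oc f = h \oc f -> g = h.

Definition is_kernel (X Y K : C) (f : mor X Y) (k : mor K X) : Prop :=
  f \oc k = 0 /\
  forall (W : C) (g : mor W X), f \oc g = 0 -> exists! h : mor W K, k \oc h = g.

Definition is_cokernel (X Y Q : C) (f : mor X Y) (q : mor Y Q) : Prop :=
  q \oc f = 0 /\
  forall (Z : C) (g : mor Y Z), g \oc f = 0 -> exists! h : mor Q Z, h \oc q = g.

(* [X] is the direct sum (biproduct) of the [S a], [a < n]; for [n = 0] this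
   says that [X] is a zero object. *)
Definition is_direct_sum (n : nat) (S : 'I_n -> C) (X : C) : Prop :=
  exists (i : forall a, mor (S a) X) (p : forall a, mor X (S a)),
    [/\ forall a, p a \oc i a = idm (S a),
        forall a b, a != b -> p a \oc i b = 0
      & \sum_(a < n) (i a \oc p a) = idm X].

Definition is_zero_obj (X : C) : Prop := idm X = 0.

Definition simple_obj (X : C) : Prop :=
  ~ is_zero_obj X /\
  forall (Y : C) (f : mor Y X), mono f -> is_zero_obj Y \/ is_iso f.

Definition is_simple_system (n : nat) (S : 'I_n -> C) : Prop :=
  [/\ forall a, simple_obj (S a),
      forall a b, isomorphic (S a) (S b) -> a = b
    & forall X, simple_obj X -> exists a, isomorphic X (S a)].

Definition abelian_cat : Prop :=
  [/\ forall (n : nat) (S : 'I_n -> C), exists X, is_direct_sum S X,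
      forall (X Y : C) (f : mor X Y), exists (K : C) (k : mor K X), is_kernel f k,
      forall (X Y : C) (f : mor X Y), exists (Q : C) (q : mor Y Q), is_cokernel f q,
      forall (K X : C) (k : mor K X), mono k ->
        exists (Y : C) (f : mor X Y), is_kernel f k
    & forall (Y Q : C) (q : mor Y Q), epi q ->
        exists (X : C) (f : mor X Y), is_cokernel f q].

Definition semisimple_cat : Prop :=
  forall X : C, exists (n : nat) (S : 'I_n -> C),
    (forall a, simple_obj (S a)) /\ is_direct_sum S X.

Definition finitely_many_simples : Prop :=
  exists s : {n & 'I_n -> C}, is_simple_system (tagged s).

End LinearCategoryNotions.

Record monoidal_category (R : realType) := MonoidalCategory {
  lincat :> linear_category R;
  unit_obj : lincat;
  tens : lincat -> lincat -> lincat;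
  tensm : forall X X' Y Y' : lincat,
    mor X X' -> mor Y Y' -> mor (tens X Y) (tens X' Y');
  tensm1 : forall X Y, tensm (idm X) (idm Y) = idm (tens X Y);
  tensm_comp : forall (X X' X'' Y Y' Y'' : lincat)
    (f' : mor X' X'') (f : mor X X') (g' : mor Y' Y'') (g : mor Y Y'),
    tensm (f' \oc f) (g' \oc g) = tensm f' g' \oc tensm f g;
  tensm_linearl : forall (X X' Y Y' : lincat) (g : mor Y Y') (a : R[i])
    (f f' : mor X X'), tensm (a *: f + f') g = a *: tensm f g + tensm f' g;
  tensm_linearr : forall (X X' Y Y' : lincat) (f : mor X X') (a : R[i])
    (g g' : mor Y Y'), tensm f (a *: g + g') = a *: tensm f g + tensm f g';
  assoc : forall X Y Z, mor (tens (tens X Y) Z) (tens X (tens Y Z));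
  assoc_inv : forall X Y Z, mor (tens X (tens Y Z)) (tens (tens X Y) Z);
  assocK : forall X Y Z, assoc_inv X Y Z \oc assoc X Y Z = idm _;
  assoc_invK : forall X Y Z, assoc X Y Z \oc assoc_inv X Y Z = idm _;
  assoc_nat : forall (X X' Y Y' Z Z' : lincat)
    (f : mor X X') (g : mor Y Y') (h : mor Z Z'),
    assoc X' Y' Z' \oc tensm (tensm f g) h = tensm f (tensm g h) \oc assoc X Y Z;
  lunit : forall X, mor (tens unit_obj X) X;
  lunit_iso : forall X, is_iso (lunit X);
  lunit_nat : forall (X X' : lincat) (f : mor X X'),
    lunit X' \oc tensm (idm unit_obj) f = f \oc lunit X;
  runit : forall X, mor (tens X unit_obj) X;
  runit_iso : forall X, is_iso (runit X);
  runit_nat : forall (X X' : lincat) (f : mor X X'),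
    runit X' \oc tensm f (idm unit_obj) = f \oc runit X;
  pentagon : forall W X Y Z,
    tensm (idm W) (assoc X Y Z) \oc assoc W (tens X Y) Z
      \oc tensm (assoc W X Y) (idm Z)
    = assoc W X (tens Y Z) \oc assoc (tens W X) Y Z;
  triangle : forall X Y,
    tensm (idm X) (lunit Y) \oc assoc X unit_obj Y = tensm (runit X) (idm Y);
}.

Arguments unit_obj {R m} : rename.
Arguments tens {R m} X Y : rename.
Arguments tensm {R m X X' Y Y'} f g : rename.
Arguments assoc {R m} X Y Z : rename.
Arguments assoc_inv {R m} X Y Z : rename.
Arguments lunit {R m} X : rename.
Arguments runit {R m} X : rename.

Notation "X \ox Y" := (tens X Y) (at level 40, left associativity) : cat_scope.
Notation "f \om g" := (tensm f g) (at level 40, left associativity) : cat_scope.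

Section MonoidalCategoryNotions.
Variables (R : realType) (C : monoidal_category R).

(* [L] is a left dual of [X], equivalently [X] is a right dual of [L].  The two
   snake identities are written without the inverses of the unitors. *)
Definition is_left_dual (X L : C) : Prop :=
  exists (ev : mor (L \ox X) unit_obj) (coev : mor unit_obj (X \ox L)),
    runit X \oc (idm X \om ev) \oc assoc X L X \oc (coev \om idm X) = lunit X /\
    lunit L \oc (ev \om idm L) \oc assoc_inv L X L \oc (idm L \om coev) = runit L.

Definition rigid : Prop :=
  forall X : C, (exists L, is_left_dual X L) /\ (exists L, is_left_dual L X).

Definition is_fusion : Prop :=
  [/\ abelian_cat C /\ semisimple_cat C, finitely_many_simples C, rigid
    & simple_obj (unit_obj : C)].

End MonoidalCategoryNotions.

Record fusion_category (R : realType) := FusionCategory {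
  moncat :> monoidal_category R;
  fusionP : is_fusion moncat;
}.

Definition full_sub_linear (R : realType) (C : linear_category R) (P : C -> Prop) :
  linear_category R :=
  @LinearCategory R {X : C | P X} (fun X Y => mor (sval X) (sval Y))
    (fun X => idm (sval X)) (fun _ _ _ g f => g \oc f)
    (fun _ _ => @comp1m R C _ _) (fun _ _ => @compm1 R C _ _)
    (fun _ _ _ _ => @compA R C _ _ _ _)
    (fun _ _ _ => @comp_linearl R C _ _ _) (fun _ _ _ => @comp_linearr R C _ _ _).

Section FullMonoidalSubcategory.
Variables (R : realType) (C : monoidal_category R) (P : C -> Prop).
Hypotheses (P1 : P unit_obj) (Ptens : forall X Y : C, P X -> P Y -> P (X \ox Y)).

Let D := full_sub_linear P.

Definition full_sub_monoidal : monoidal_category R :=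
  @MonoidalCategory R D (exist P unit_obj P1)
    (fun X Y => exist P (sval X \ox sval Y) (Ptens (proj2_sig X) (proj2_sig Y)))
    (fun _ _ _ _ f g => f \om g)
    (fun _ _ => @tensm1 R C _ _)
    (fun _ _ _ _ _ _ => @tensm_comp R C _ _ _ _ _ _)
    (fun _ _ _ _ => @tensm_linearl R C _ _ _ _)
    (fun _ _ _ _ => @tensm_linearr R C _ _ _ _)
    (fun X Y Z => assoc (sval X) (sval Y) (sval Z))
    (fun X Y Z => assoc_inv (sval X) (sval Y) (sval Z))
    (fun _ _ _ => @assocK R C _ _ _) (fun _ _ _ => @assoc_invK R C _ _ _)
    (fun _ _ _ _ _ _ => @assoc_nat R C _ _ _ _ _ _)
    (fun X => lunit (sval X)) (fun X => lunit_iso (sval X))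
    (fun _ _ => @lunit_nat R C _ _)
    (fun X => runit (sval X)) (fun X => runit_iso (sval X))
    (fun _ _ => @runit_nat R C _ _)
    (fun _ _ _ _ => @pentagon R C _ _ _ _) (fun _ _ => @triangle R C _ _).

End FullMonoidalSubcategory.

(* A full monoidal subcategory, closed under direct summands (in particular
   under isomorphism), which is itself a fusion category. *)
Record fusion_subcategory (R : realType) (C : fusion_category R) :=
  FusionSubcategory {
  in_sub :> C -> Prop;
  in_sub_one : in_sub unit_obj;
  in_sub_tens : forall X Y : C, in_sub X -> in_sub Y -> in_sub (X \ox Y);
  in_sub_summand : forall (X Y : C) (i : mor Y X) (p : mor X Y),
    p \oc i = idm Y -> in_sub X -> in_sub Y;
  in_sub_fusion : is_fusion (full_sub_monoidal in_sub_one in_sub_tens);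
}.

Definition sub_fusion (R : realType) (C : fusion_category R)
  (D : fusion_subcategory C) : fusion_category R := FusionCategory (in_sub_fusion D).

Section FusionCategoryNotions.
Variables (R : realType) (C : fusion_category R).

Lemma fusion_finite : finitely_many_simples C.
Proof. by case: (fusionP C). Qed.

(* A chosen system of representatives of the simple objects; all the notions
   below are independent of the choice. *)
Definition rank : nat := tag (projT1 (cid fusion_finite)).

Definition irr : 'I_rank -> C := tagged (projT1 (cid fusion_finite)).

(* Left multiplication by the class of [X] on the Grothendieck ring in the basis
   of simple objects: the multiplicity of [irr k] in [X \ox irr j], which is the
   dimension of Hom(irr k, X \ox irr j) by Schur's lemma. *)
Definition mult_mx (X : C) : 'M[R]_rank :=
  \matrix_(j, k) (\dim {:mor (irr k) (X \ox irr j)})%:R.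

(* The largest nonnegative real eigenvalue (a finite set has its sup as max). *)
Definition FPdim (X : C) : R :=
  sup [set x : R | 0 <= x /\ eigenvalue (mult_mx X) x]%classic.

Definition FPdim_cat : R := \sum_(j < rank) FPdim (irr j) ^+ 2.

End FusionCategoryNotions.

(* Main.v *)
(* Write d = FPdim rho, so that d^2 = N + kappa d, and d is irrational.  For X in D
   both X rho and rho X are multiples of rho.  Consider the right D-module functors W
   from the subcategory generated by rho to C (for instance the inclusion, or
   Z (x) -), and let p(W) be the Frobenius-Perron dimension of the internal Hom from W
   to the inclusion; it has the form s + d r with s, r integers.  If W takes values in
   multiples of rho, say W(rho) = rho^m, then rho W splits as Q + W' with Q valued in D
   and W'(rho) = rho^(kappa m), and p(rho W) = d p(W), while p(Q) = d m by duality.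
   Hence d p(W) = d m + p(W'), and since kappa < d and p(W) = O(m) this recursion
   forces p(W) = m d / (d - kappa).  For the inclusion this reads
   s + d r = 1 + (kappa / N) d, and irrationality of d gives kappa = N r. *)
Require Import Defs.
From HB Require Import structures.
From mathcomp Require Import all_boot all_order all_algebra.
From mathcomp Require Import complex.
From mathcomp Require Import boolp classical_sets reals.
From mathcomp Require Import ring lra.

Set Implicit Arguments.
Unset Strict Implicit.
Unset Printing Implicit Defensive.

Import Order.TTheory GRing.Theory Num.Theory.
Local Open Scope ring_scope.
Local Open Scope cat_scope.

(** * Linear and monoidal categories *)

(* Unqualified, [compA] is the associativity of composition of functions. *)
Local Notation ocA := Defs.compA.

Section LinearBasics.
Variables (R : realType) (C : linear_category R).

(** On [D], the functor sending X to Hom(rho X, rho) is represented by an algebra A of dimension N,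
    and a module functor amounts to a right A-module in [C]. Neither A nor any internal Hom is
    constructed. The multiplicity of a simple Z in the internal Hom from W to the inclusion is the
    dimension of the space of module maps Z W -> rho, and p(W) is defined as the sum of these
    numbers weighted by Frobenius-Perron dimensions; this is why s and r are integers. The obstacle
    is that a module carried by rho^m is not known to split into m copies of the inclusion, so p(W)
    cannot be obtained from m by additivity. Only modules carried by [D] are computed directly.
    Tensoring with rho produces one of them at each stage, and the unknown remainder is controlled
    by comparing the growth of d^n with that of kappa^n. *)

Lemma compDl (X Y Z : C) (f : mor X Y) (g h : mor Y Z) :
  (g + h) \oc f = (g \oc f) + (h \oc f).
Proof. by have := comp_linearl f 1 g h; rewrite !scale1r. Qed.

Lemma compDr (X Y Z : C) (h : mor Y Z) (f g : mor X Y) :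
  h \oc (f + g) = (h \oc f) + (h \oc g).
Proof. by have := comp_linearr h 1 f g; rewrite !scale1r. Qed.

Lemma comp0m (X Y Z : C) (f : mor X Y) : (0 : mor Y Z) \oc f = 0.
Proof. by apply: (addrI ((0 : mor Y Z) \oc f)); rewrite -compDl !addr0. Qed.

Lemma compm0 (X Y Z : C) (h : mor Y Z) : h \oc (0 : mor X Y) = 0.
Proof. by apply: (addrI (h \oc (0 : mor X Y))); rewrite -compDr !addr0. Qed.

Lemma compZl (X Y Z : C) (f : mor X Y) a (g : mor Y Z) :
  (a *: g) \oc f = a *: (g \oc f).
Proof. by have := comp_linearl f a g 0; rewrite !addr0 comp0m addr0. Qed.

Lemma compZr (X Y Z : C) (h : mor Y Z) a (f : mor X Y) :
  h \oc (a *: f) = a *: (h \oc f).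
Proof. by have := comp_linearr h a f 0; rewrite !addr0 compm0 addr0. Qed.

Lemma compNl (X Y Z : C) (f : mor X Y) (g : mor Y Z) :
  - g \oc f = - (g \oc f).
Proof. by rewrite -scaleN1r compZl scaleN1r. Qed.

Lemma compNr (X Y Z : C) (h : mor Y Z) (f : mor X Y) : h \oc (- f) = - (h \oc f).
Proof. by rewrite -scaleN1r compZr scaleN1r. Qed.

Lemma comp_suml (X Y Z : C) (f : mor X Y) I (r : seq I) (P : pred I)
    (g : I -> mor Y Z) :
  (\sum_(i <- r | P i) g i) \oc f = \sum_(i <- r | P i) (g i \oc f).
Proof.
exact: (big_morph (fun u => u \oc f) (fun a b => compDl f a b) (comp0m _ f)).
Qed.

Lemma comp_sumr (X Y Z : C) (h : mor Y Z) I (r : seq I) (P : pred I)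
    (f : I -> mor X Y) :
  h \oc (\sum_(i <- r | P i) f i) = \sum_(i <- r | P i) (h \oc f i).
Proof.
exact: (big_morph (fun u => h \oc u) (fun a b => compDr h a b) (compm0 _ h)).
Qed.

Lemma comp_reassoc (W X Y Z : C) (b : mor Y Z) (c : mor X Y) k :
  b \oc c = k -> forall a : mor Z W, a \oc b \oc c = a \oc k.
Proof. by move=> <- a; rewrite ocA. Qed.

Lemma iso_sym (X Y : C) : isomorphic X Y -> isomorphic Y X.
Proof. by case=> f [g [gf fg]]; exists g; exists f. Qed.

Lemma iso_refl (X : C) : isomorphic X X.
Proof. by exists (idm X), (idm X); rewrite comp1m. Qed.

Lemma iso_trans (X Y Z : C) : isomorphic X Y -> isomorphic Y Z -> isomorphic X Z.
Proof.
case=> f [f' [f'f ff']] [g [g' [g'g gg']]].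
exists (g \oc f), (f' \oc g'); split.
  by rewrite ocA (comp_reassoc g'g) compm1.
by rewrite ocA (comp_reassoc ff') compm1.
Qed.

Lemma iso_cancell (X Y Z : C) (f : mor Y Z) (g h : mor X Y) :
  is_iso f -> f \oc g = f \oc h -> g = h.
Proof. by case=> f' [f'f _] e; rewrite -(comp1m g) -f'f -ocA e ocA f'f comp1m. Qed.

Lemma iso_cancelr (X Y Z : C) (f : mor X Y) (g h : mor Y Z) :
  is_iso f -> g \oc f = h \oc f -> g = h.
Proof. by case=> f' [_ ff'] e; rewrite -(compm1 g) -ff' ocA e -ocA ff' compm1. Qed.

End LinearBasics.

Section MonoidalBasics.
Variables (R : realType) (C : monoidal_category R).

Lemma tensDl (X X' Y Y' : C) (g : mor Y Y') (f f' : mor X X') :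
  (f + f') \om g = f \om g + f' \om g.
Proof. by have := tensm_linearl g 1 f f'; rewrite !scale1r. Qed.

Lemma tensDr (X X' Y Y' : C) (f : mor X X') (g g' : mor Y Y') :
  f \om (g + g') = f \om g + f \om g'.
Proof. by have := tensm_linearr f 1 g g'; rewrite !scale1r. Qed.

Lemma tens0m (X X' Y Y' : C) (g : mor Y Y') : (0 : mor X X') \om g = 0.
Proof. by apply: (addrI ((0 : mor X X') \om g)); rewrite -tensDl !addr0. Qed.

Lemma tensm0 (X X' Y Y' : C) (f : mor X X') : f \om (0 : mor Y Y') = 0.
Proof. by apply: (addrI (f \om (0 : mor Y Y'))); rewrite -tensDr !addr0. Qed.

Lemma tensZl (X X' Y Y' : C) (g : mor Y Y') a (f : mor X X') :
  (a *: f) \om g = a *: (f \om g).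
Proof. by have := tensm_linearl g a f 0; rewrite !addr0 tens0m addr0. Qed.

Lemma tens_suml (X X' Y Y' : C) (g : mor Y Y') I (r : seq I) (P : pred I)
    (f : I -> mor X X') :
  (\sum_(i <- r | P i) f i) \om g = \sum_(i <- r | P i) (f i \om g).
Proof.
exact: (big_morph (fun u => u \om g) (fun a b => tensDl g a b) (tens0m _ _ g)).
Qed.

Lemma tens_sumr (X X' Y Y' : C) (f : mor X X') I (r : seq I) (P : pred I)
    (g : I -> mor Y Y') :
  f \om (\sum_(i <- r | P i) g i) = \sum_(i <- r | P i) (f \om g i).
Proof.
exact: (big_morph (fun u => f \om u) (fun a b => tensDr f a b) (tensm0 _ _ f)).
Qed.

Lemma tens_idl (X Y Y' Y'' : C) (g' : mor Y' Y'') (g : mor Y Y') :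
  idm X \om (g' \oc g) = (idm X \om g') \oc (idm X \om g).
Proof. by rewrite -tensm_comp comp1m. Qed.

Lemma tens_idr (X X' X'' Y : C) (f' : mor X' X'') (f : mor X X') :
  (f' \oc f) \om idm Y = (f' \om idm Y) \oc (f \om idm Y).
Proof. by rewrite -tensm_comp comp1m. Qed.

Lemma tens_swap (X X' Y Y' : C) (f : mor X X') (g : mor Y Y') :
  (f \om idm Y') \oc (idm X \om g) = (idm X' \om g) \oc (f \om idm Y).
Proof. by rewrite -!tensm_comp !comp1m !compm1. Qed.

Lemma assoc_inv_nat (X X' Y Y' Z Z' : C)
    (f : mor X X') (g : mor Y Y') (h : mor Z Z') :
  assoc_inv X' Y' Z' \oc (f \om (g \om h)) = (f \om g) \om h \oc assoc_inv X Y Z.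
Proof.
have isoa : is_iso (assoc X' Y' Z').
  by exists (assoc_inv X' Y' Z'); rewrite assocK assoc_invK.
apply: (iso_cancell isoa).
by rewrite !ocA assoc_invK comp1m assoc_nat -ocA assoc_invK compm1.
Qed.

Lemma assoc_iso (X Y Z : C) : is_iso (assoc X Y Z).
Proof. by exists (assoc_inv X Y Z); rewrite assocK assoc_invK. Qed.

Lemma tens_iso (X X' Y Y' : C) (f : mor X X') (g : mor Y Y') :
  is_iso f -> is_iso g -> is_iso (f \om g).
Proof.
case=> f' [f'f ff'] [g' [g'g gg']]; exists (f' \om g').
by rewrite -!tensm_comp f'f ff' g'g gg' !tensm1.
Qed.

Lemma id_iso (X : C) : is_iso (idm X).
Proof. by exists (idm X); rewrite comp1m. Qed.

Lemma runit_unit_faithful (X Y : C) (f g : mor X Y) :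
  f \om idm unit_obj = g \om idm unit_obj -> f = g.
Proof. by move=> e; apply: (iso_cancelr (runit_iso X)); rewrite -!runit_nat e. Qed.

Lemma tens_isomorphic (X X' Y Y' : C) :
  isomorphic X X' -> isomorphic Y Y' -> isomorphic (X \ox Y) (X' \ox Y').
Proof. by case=> f hf [g hg]; exists (f \om g); apply: tens_iso. Qed.

(* Kelly: redundancy of one of the original unit axioms of Mac Lane. *)
Lemma runit_tens (X Y : C) :
  (idm X \om runit Y) \oc assoc X Y unit_obj = runit (X \ox Y).
Proof.
apply: runit_unit_faithful; rewrite tens_idr.
apply: (iso_cancell (assoc_iso _ _ _)).
rewrite ocA assoc_nat -(triangle Y) tens_idl.
rewrite -(ocA _ (assoc X (Y \ox unit_obj) unit_obj)).
rewrite -(ocA _ (idm X \om assoc Y unit_obj unit_obj)) (ocA (idm X \om assoc Y unit_obj unit_obj)).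
rewrite pentagon ocA -assoc_nat tensm1 -ocA triangle //.
Qed.

Lemma pentagon_inv (W X Y Z : C) :
  assoc_inv W X Y \om idm Z \oc assoc_inv W (X \ox Y) Z \oc (idm W \om assoc_inv X Y Z)
  = assoc_inv (W \ox X) Y Z \oc assoc_inv W X (Y \ox Z).
Proof.
apply: (iso_cancell (assoc_iso (W \ox X) Y Z)).
apply: (iso_cancell (assoc_iso W X (Y \ox Z))).
rewrite [RHS]ocA !ocA -pentagon.
have aK (U V T : C) : assoc U V T \oc assoc_inv U V T = idm _ := assoc_invK U V T.
rewrite (comp_reassoc (k := idm _)); last by rewrite -tens_idr aK tensm1.
rewrite compm1 (comp_reassoc (aK _ _ _)) compm1 -tens_idl aK tensm1.
rewrite pentagon.
by rewrite (comp_reassoc (aK _ _ _)) compm1 aK.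
Qed.

Lemma triangle_inv (X Y : C) :
  (runit X \om idm Y) \oc assoc_inv X unit_obj Y = idm X \om lunit Y.
Proof. by rewrite -triangle (comp_reassoc (assoc_invK _ _ _)) compm1. Qed.

End MonoidalBasics.

(** Reversing the tensor product exchanges the two unitors, and [assoc] with [assoc_inv], so that
    facts about right multiplication can be read as facts about left multiplication. It ends in
    [Defined] because later proofs unfold it by conversion. *)
Definition rev_monoidal (R : realType) (C : monoidal_category R) :
  monoidal_category R.
refine (@MonoidalCategory R C unit_obj (fun X Y => Y \ox X)
    (fun _ _ _ _ f g => g \om f)
    (fun _ _ => @tensm1 R C _ _)
    (fun _ _ _ _ _ _ f' f g' g => @tensm_comp R C _ _ _ _ _ _ g' g f' f)
    (fun _ _ _ _ => @tensm_linearr R C _ _ _ _)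
    (fun _ _ _ _ => @tensm_linearl R C _ _ _ _)
    (fun X Y Z => assoc_inv Z Y X)
    (fun X Y Z => assoc Z Y X)
    (fun _ _ _ => @assoc_invK R C _ _ _) (fun _ _ _ => @assocK R C _ _ _)
    (fun _ _ _ _ _ _ f g h => assoc_inv_nat h g f)
    (fun X => runit X) (fun X => runit_iso X)
    (fun _ _ => @runit_nat R C _ _)
    (fun X => lunit X) (fun X => lunit_iso X)
    (fun _ _ => @lunit_nat R C _ _)
    (fun W X Y Z => pentagon_inv Z Y X W) (fun X Y => triangle_inv Y X)).
Defined.

(** * Duality *)

Section Duality.
Variables (R : realType) (C : monoidal_category R).

Definition is_duality (X L : C) (ev : mor (L \ox X) unit_obj)
    (coev : mor unit_obj (X \ox L)) : Prop :=
  runit X \oc (idm X \om ev) \oc assoc X L X \oc (coev \om idm X) = lunit X /\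
  lunit L \oc (ev \om idm L) \oc assoc_inv L X L \oc (idm L \om coev) = runit L.

(** The source stays [A \ox unit_obj], so that no inverse of a unitor enters the formula; the round
    trips below take a one-sided inverse [r] of [runit A] as a parameter instead. *)
Definition transpose (A X L B : C) (coev : mor unit_obj (X \ox L))
    (f : mor (A \ox X) B) : mor (A \ox unit_obj) (B \ox L) :=
  (f \om idm L) \oc assoc_inv A X L \oc (idm A \om coev).

Definition untranspose (A X L B : C) (ev : mor (L \ox X) unit_obj)
    (g : mor A (B \ox L)) : mor (A \ox X) B :=
  runit B \oc (idm B \om ev) \oc assoc B L X \oc (g \om idm X).

Lemma transposeK (A X L B : C) ev coev (f : mor (A \ox X) B) r :
  @is_duality X L ev coev -> runit A \oc r = idm A ->
  untranspose ev (transpose coev f \oc r) = f.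
Proof.
move=> [snake _] rK; rewrite /untranspose /transpose !tens_idr !ocA.
rewrite (comp_reassoc (assoc_nat _ _ _)) tensm1 !ocA.
rewrite (comp_reassoc (esym (tens_swap _ _))) !ocA runit_nat.
(* The pentagon, solved for the composite at hand: it brings [assoc X L X] next to the coevaluation,
   where the snake identity applies. *)
have pent : assoc (A \ox X) L X \oc (assoc_inv A X L \om idm X) =
    assoc_inv A X (L \ox X) \oc (idm A \om assoc X L X) \oc assoc A (X \ox L) X.
  apply: (iso_cancell (assoc_iso A X (L \ox X))).
  rewrite !ocA assoc_invK comp1m -pentagon -ocA -tens_idr assoc_invK tensm1.
  by rewrite compm1.
rewrite (comp_reassoc pent) !ocA (comp_reassoc (assoc_nat _ _ _)) !ocA.
rewrite -(tensm1 A X) (comp_reassoc (esym (assoc_inv_nat _ _ _))) !ocA.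
rewrite -runit_tens !ocA (comp_reassoc (assoc_invK _ _ _)) compm1.
rewrite !(comp_reassoc (esym (tens_idl _ _ _))) !ocA snake.
by rewrite (comp_reassoc (triangle _ _)) -(ocA f) -tens_idr rK tensm1 compm1.
Qed.

Lemma untransposeK (A X L B : C) ev coev (g : mor (A \ox unit_obj) (B \ox L)) r :
  @is_duality X L ev coev -> r \oc runit A = idm (A \ox unit_obj) ->
  transpose coev (untranspose ev (g \oc r)) = g.
Proof.
move=> [_ snake] rK; rewrite /untranspose /transpose !tens_idr !ocA.
rewrite (comp_reassoc (esym (assoc_inv_nat _ _ _))) tensm1 !ocA.
rewrite (comp_reassoc (esym (assoc_inv_nat _ _ _))) tensm1 !ocA.
rewrite (comp_reassoc (tens_swap _ _)) !ocA.
rewrite (comp_reassoc (tens_swap _ _)) !ocA.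
have pent : (assoc B L X \om idm L) \oc assoc_inv (B \ox L) X L =
    assoc_inv B (L \ox X) L \oc (idm B \om assoc_inv L X L) \oc assoc B L (X \ox L).
  apply: (iso_cancelr (assoc_iso (B \ox L) X L)).
  rewrite -ocA assocK compm1 -!ocA -pentagon.
  rewrite !ocA -(ocA _ (idm B \om assoc_inv L X L)) -tens_idl assocK tensm1 compm1.
  by rewrite assocK comp1m.
rewrite (comp_reassoc pent) !ocA.
rewrite -(tensm1 B L) (comp_reassoc (assoc_nat _ _ _)) !ocA.
rewrite (comp_reassoc (esym (assoc_inv_nat _ _ _))) !ocA triangle_inv.
rewrite -!tens_idl snake runit_tens runit_nat -ocA.
by rewrite runit_nat rK compm1.
Qed.

End Duality.

(* In the reversed category the roles of a dual pair are exchanged, so the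
   adjunction for left multiplication is the one above read there. *)
Section LeftDuality.
Variables (R : realType) (C : monoidal_category R).

Lemma rev_duality (X L : C) ev coev :
  @is_duality R C X L ev coev -> @is_duality R (rev_monoidal C) L X ev coev.
Proof. by case=> s1 s2; split=> /=. Qed.

Definition ltranspose (A X L B : C) (coev : mor unit_obj (X \ox L))
    (f : mor (L \ox A) B) : mor (unit_obj \ox A) (X \ox B) :=
  (idm X \om f) \oc assoc X L A \oc (coev \om idm A).

Definition luntranspose (A X L B : C) (ev : mor (L \ox X) unit_obj)
    (g : mor A (X \ox B)) : mor (L \ox A) B :=
  lunit B \oc (ev \om idm B) \oc assoc_inv L X B \oc (idm L \om g).

Lemma luntransposeK (A X L B : C) ev coev (g : mor (unit_obj \ox A) (X \ox B)) r :
  @is_duality R C X L ev coev -> r \oc lunit A = idm (unit_obj \ox A) ->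
  ltranspose coev (luntranspose ev (g \oc r)) = g.
Proof. by move=> /rev_duality; exact: untransposeK. Qed.

(** Yoneda form of the adjunction Hom(L, B) = Hom(1, X B): [coev] corresponds to the identity of
    [L], hence every element is an image of it. *)
Lemma coev_universal (X L B : C) ev coev (x : mor unit_obj (X \ox B)) :
  @is_duality R C X L ev coev ->
  exists g : mor L B, (idm X \om g) \oc coev = x.
Proof.
move=> dual; have [l [lK Kl]] := lunit_iso (unit_obj : C).
have [r [rK Kr]] := runit_iso L.
exists (luntranspose ev (x \oc runit unit_obj \oc l) \oc r).
apply: (iso_cancelr (runit_iso unit_obj)).
rewrite -[RHS](luntransposeK (x \oc runit unit_obj) dual lK) /ltranspose.
set f := luntranspose _ _; rewrite tens_idl -ocA -(runit_nat coev) -runit_tens !ocA.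
by rewrite (comp_reassoc (esym (tens_idl _ _ _))) rK tensm1 compm1.
Qed.

End LeftDuality.

(** * Dimensions of subspaces *)

Section VectorSpaces.
Variable K : fieldType.

Definition lin (V V' : vectType K) (f : V -> V') : Prop :=
  forall a u v, f (a *: u + v) = a *: f u + f v.

Lemma lin_hom (V V' : vectType K) (f : V -> V') : lin f ->
  exists g : 'Hom(V, V'), forall u, g u = f u.
Proof.
move=> lf; pose m := GRing.isLinear.Build K V V' _ f lf.
pose g : {linear V -> V'} := HB.pack f m.
by exists (linfun g) => u; rewrite lfunE.
Qed.

(** A subspace of maximal dimension among those contained in [P] exhausts [P], since adjoining a
    missing vector would give a larger one. *)
Lemma subspace_exists (V : vectType K) (P : V -> Prop) :
  P 0 -> (forall a u v, P u -> P v -> P (a *: u + v)) ->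
  exists U : {vspace V}, forall v, v \in U <-> P v.
Proof.
move=> P0 Plin.
pose Q n := `[< exists U : {vspace V}, \dim U = n /\ forall v, v \in U -> P v >].
have exQ : exists n, Q n.
  exists 0%N; apply/asboolP; exists 0%VS; rewrite dimv0; split=> // v.
  by rewrite memv0 => /eqP ->.
have bQ n : Q n -> (n <= \dim {:V})%N.
  by move=> /asboolP [U [<- _]]; apply: dimvS; rewrite subvf.
case: (ex_maxnP exQ bQ) => n /asboolP [U [dU UP]] maxn.
exists U => v; split=> [/UP //|Pv].
have UvP w : w \in (U + <[v]>)%VS -> P w.
  move=> /memv_addP [u /UP Pu [_ /vlineP [a ->] ->]].
  by rewrite addrC; apply: Plin.
have: (\dim (U + <[v]>)%VS <= n)%N.
  by apply: maxn; apply/asboolP; exists (U + <[v]>)%VS.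
rewrite -dU => le_dim; have sU : (U <= U + <[v]>)%VS by apply: addvSl.
have /eqP -> : U == (U + <[v]>)%VS by rewrite eqEdim sU.
by apply: (subvP (addvSr _ _)); apply: memv_line.
Qed.

Lemma dim_le_inj (V V' : vectType K) (U : {vspace V}) (U' : {vspace V'})
    (f : V -> V') : lin f -> (forall u, u \in U -> f u \in U') ->
  (forall u, u \in U -> f u = 0 -> u = 0) -> (\dim U <= \dim U')%N.
Proof.
move=> /lin_hom [g gE] fU finj.
rewrite -(@limg_dim_eq _ _ _ g U).
  by apply/dimvS/subvP => _ /memv_imgP [u uU ->]; rewrite gE; apply: fU.
apply/eqP; rewrite -subv0; apply/subvP => u; rewrite memv_cap memv_ker memv0.
by move=> /andP [uU /eqP]; rewrite gE => /(finj _ uU) ->.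
Qed.

Lemma dim_eq_bij (V V' : vectType K) (U : {vspace V}) (U' : {vspace V'})
    (f : V -> V') (g : V' -> V) : lin f -> lin g ->
  (forall u, u \in U -> f u \in U') -> (forall u, u \in U' -> g u \in U) ->
  (forall u, u \in U -> g (f u) = u) -> (forall u, u \in U' -> f (g u) = u) ->
  \dim U = \dim U'.
Proof.
have lin0 (W W' : vectType K) (h : W -> W') : lin h -> h 0 = 0.
  by move=> /lin_hom [h' e]; rewrite -e linear0.
move=> lf lg fU gU fK gK; apply/eqP; rewrite eqn_leq.
rewrite (dim_le_inj lf fU) /=; last first.
  by move=> u uU fu0; rewrite -(fK u uU) fu0 (lin0 _ _ _ lg).
rewrite (dim_le_inj lg gU) //.
by move=> u uU gu0; rewrite -(gK u uU) gu0 (lin0 _ _ _ lf).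
Qed.

(** Subspaces [U] and [T i] are allowed because the lemma also serves for spaces of module maps
    inside Hom spaces. *)
Lemma dim_decomp (I : finType) (V : vectType K) (W : I -> vectType K)
    (U : {vspace V}) (T : forall i, {vspace W i})
    (a : forall i, V -> W i) (b : forall i, W i -> V) :
  (forall i, lin (a i)) -> (forall i, lin (b i)) ->
  (forall i u, u \in U -> a i u \in T i) ->
  (forall i w, w \in T i -> b i w \in U) ->
  (forall u, u \in U -> \sum_i b i (a i u) = u) ->
  (forall i w, w \in T i -> a i (b i w) = w) ->
  (forall i j w, i != j -> w \in T j -> a i (b j w) = 0) ->
  \dim U = (\sum_i \dim (T i))%N.
Proof.
move=> la lb aU bT ba ab ab0.
have /fin_all_exists [a' a'E] i : exists g : 'Hom(V, W i), forall u, g u = a i u.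
  exact: lin_hom.
have /fin_all_exists [b' b'E] i : exists g : 'Hom(W i, V), forall u, g u = b i u.
  exact: lin_hom.
have UE : U = (\sum_i b' i @: T i)%VS.
  apply/eqP; rewrite eqEsubv; apply/andP; split; apply/subvP => u.
    move=> uU; rewrite -(ba u uU); apply: memv_suml => i _.
    rewrite -b'E; apply: (subvP (sumv_sup i (Vs := fun i => (b' i @: T i)%VS) isT (subvv _))).
    by apply: memv_img; apply: aU.
  move=> /memv_sumP [w wT ->]; apply: memv_suml => i _.
  by have /memv_imgP [x xT ->] := wT i isT; rewrite b'E; apply: bT.
have dir : directv (\sum_i b' i @: T i)%VS.
  apply/directv_sum_independent => w wT w0 i _.
  have /memv_imgP [x xT wE] := wT i isT.
  have : a' i (\sum_j w j) = 0 by rewrite w0 linear0.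
  rewrite linear_sum (bigD1 i) //= big1 ?addr0 => [|j ji].
    by rewrite wE a'E b'E ab // => ->; rewrite -b'E linear0.
  have /memv_imgP [y yT ->] := wT j isT.
  by rewrite a'E b'E ab0 // eq_sym.
rewrite {1}UE (directvP dir) /=; apply: eq_bigr => i _.
apply: limg_dim_eq; apply/eqP; rewrite -subv0; apply/subvP => w.
rewrite memv_cap memv_ker memv0 => /andP [wT /eqP bw0].
by rewrite -(ab i w wT) -b'E bw0 -a'E linear0.
Qed.

(** Nondegeneracy embeds [U] in the dual of [V2], and representability of functionals makes the
    embedding onto; both are read in coordinates on a basis of [V2]. *)
Lemma dim_pairing (V1 V2 : vectType K) (U : {vspace V1}) (B : V1 -> V2 -> K) :
  (forall v, lin (fun u => B u v : K^o)) -> (forall u, lin (B u : V2 -> K^o)) ->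
  (forall u, u \in U -> (forall v, B u v = 0) -> u = 0) ->
  (forall xi : 'Hom(V2, K^o), exists2 u, u \in U & forall v, B u v = xi v) ->
  \dim U = \dim {:V2}.
Proof.
move=> linl linr nondeg surj; set n := \dim {:V2}.
pose e := vbasis {:V2}.
have eb : basis_of {:V2} e := vbasisP _.
have /fin_all_exists2 [x xU xE] (i : 'I_n) :
    exists2 u, u \in U & forall v, B u v = coord e i v.
  have cl : lin (fun v => coord e i v : K^o) by move=> a u v; rewrite linearP.
  have [xi xiE] := lin_hom cl.
  by have [u uU uE] := surj xi; exists u => // v; rewrite uE xiE.
have B0l v : B 0 v = 0 by have [g gE] := lin_hom (linl v); rewrite -gE linear0.
have Bsum (c : 'I_n -> K) v : B (\sum_i c i *: x i) v = \sum_i c i * B (x i) v.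
  have [g gE] := lin_hom (linl v); rewrite -gE linear_sum.
  by apply: eq_bigr => i _; rewrite linearZ /= gE.
have dn : \dim {:'rV[K]_n} = n by rewrite dimvf /dim /= mul1n.
apply/eqP; rewrite eqn_leq; apply/andP; split.
  rewrite -dn; apply: (@dim_le_inj _ _ _ _ (fun u => \row_i B u (e`_i))).
  - move=> a u v; apply/rowP => i; rewrite !mxE.
    exact: (linl (e`_i) a u v).
  - by move=> *; rewrite memvf.
  move=> u uU /rowP u0; apply: nondeg => // v.
  have [g gE] := lin_hom (linr u).
  rewrite (coord_basis eb (memvf v)) -gE linear_sum big1 // => i _.
  by rewrite linearZ /= gE; have := u0 i; rewrite !mxE => ->; rewrite scaler0.
rewrite -dn; apply: (@dim_le_inj _ _ _ _ (fun c : 'rV[K]_n => \sum_i c 0 i *: x i)).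
- move=> a u v; rewrite scaler_sumr -big_split; apply: eq_bigr => i _.
  by rewrite !mxE scalerDl scalerA.
- by move=> c _; apply: memv_suml => i _; apply: memvZ.
move=> c _ c0; apply/rowP => j; rewrite mxE.
have := Bsum (fun i => c 0 i) (e`_j); rewrite c0 B0l (bigD1 j) //= big1 => [|i ij].
  rewrite xE coord_free ?(basis_free eb) // eqxx mulr1 addr0; exact: esym.
by rewrite xE coord_free ?(basis_free eb) // eq_sym (negPf ij) mulr0.
Qed.

End VectorSpaces.

(** * Semisimple categories *)

Section Semisimple.
Import VectorInternalTheory.
Variables (R : realType) (C : linear_category R).

Definition biproduct (I : finType) (S : I -> C) (X : C)
    (i : forall a, mor (S a) X) (p : forall a, mor X (S a)) : Prop :=
  [/\ forall a, p a \oc i a = idm (S a),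
      forall a b, a != b -> p a \oc i b = 0
    & \sum_a (i a \oc p a) = idm X].

Lemma biproduct_transport (I : finType) (S T : I -> C) (X : C) i p :
  (forall a, isomorphic (S a) (T a)) -> @biproduct I S X i p ->
  exists i' p', @biproduct I T X i' p'.
Proof.
move=> /fin_all_exists [f] /fin_all_exists [g gf] [pi pi0 ip].
exists (fun a => i a \oc g a), (fun a => f a \oc p a); split=> [a|a b ab|].
- by rewrite ocA (comp_reassoc (pi a)) compm1; case: (gf a).
- by rewrite ocA (comp_reassoc (pi0 a b ab)) compm0 comp0m.
rewrite -ip; apply: eq_bigr => a _; rewrite ocA.
by case: (gf a) => e _; rewrite (comp_reassoc e) compm1.
Qed.

Lemma direct_sum1 (X Y : C) : isomorphic X Y -> is_direct_sum (fun _ : 'I_1 => X) Y.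
Proof.
case=> f [g [gf fg]]; exists (fun=> f), (fun=> g).
by split=> // [a b|]; [rewrite !ord1|rewrite big_ord1].
Qed.

Lemma direct_sum_iso (n : nat) (S : 'I_n -> C) (X Y : C) :
  is_direct_sum S X -> is_direct_sum S Y -> isomorphic X Y.
Proof.
have key (Z T : C) (i : forall a, mor (S a) Z) p (j : forall a, mor (S a) T) q :
    biproduct i p -> biproduct j q ->
    (\sum_a (i a \oc q a)) \oc (\sum_a (j a \oc p a)) = idm Z.
  move=> [pi pi0 ip] [qj qj0 _]; rewrite comp_suml -ip.
  apply: eq_bigr => a _; rewrite comp_sumr (bigD1 a) //= big1 => [|b ba].
    by rewrite addr0 ocA (comp_reassoc (qj a)) compm1.
  by rewrite ocA (comp_reassoc (qj0 a b _)) ?compm0 ?comp0m // eq_sym.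
case=> i [p bX] [j [q bY]].
exists (\sum_a (j a \oc p a)), (\sum_a (i a \oc q a)).
by split; apply: key.
Qed.

Lemma dim_hom_suml (I : finType) (S : I -> C) (X Y : C) i p :
  @biproduct I S X i p -> \dim {:mor X Y} = (\sum_a \dim {:mor (S a) Y})%N.
Proof.
move=> [pi pi0 ip].
apply: (@dim_decomp _ I (mor X Y) (fun a => mor (S a) Y) fullv (fun=> fullv)
  (fun a f => f \oc i a) (fun a f => f \oc p a)).
- by move=> a c u v; rewrite compDl compZl.
- by move=> a c u v; rewrite compDl compZl.
- by move=> *; apply: memvf.
- by move=> *; apply: memvf.
- move=> u _; rewrite -[RHS]compm1 -ip comp_sumr.
  by apply: eq_bigr => a _; rewrite ocA.
- by move=> a w _; rewrite -ocA pi compm1.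
- by move=> a b w ab _; rewrite -ocA pi0 ?compm0 // eq_sym.
Qed.

Lemma dim_hom_sumr (I : finType) (S : I -> C) (X Y : C) i p :
  @biproduct I S X i p -> \dim {:mor Y X} = (\sum_a \dim {:mor Y (S a)})%N.
Proof.
move=> [pi pi0 ip].
apply: (@dim_decomp _ I (mor Y X) (fun a => mor Y (S a)) fullv (fun=> fullv)
  (fun a f => p a \oc f) (fun a f => i a \oc f)).
- by move=> a c u v; rewrite compDr compZr.
- by move=> a c u v; rewrite compDr compZr.
- by move=> *; apply: memvf.
- by move=> *; apply: memvf.
- move=> u _; rewrite -[RHS]comp1m -ip comp_suml.
  by apply: eq_bigr => a _; rewrite ocA.
- by move=> a w _; rewrite ocA pi comp1m.
- by move=> a b w ab _; rewrite ocA pi0 ?comp0m.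
Qed.

Lemma dim_hom_isol (X X' Y : C) : isomorphic X X' ->
  \dim {:mor X Y} = \dim {:mor X' Y}.
Proof.
move=> /iso_sym /direct_sum1 [i [p b]].
by rewrite (dim_hom_suml _ b) big_ord1.
Qed.

Lemma dim_hom_isor (X X' Y : C) : isomorphic X X' ->
  \dim {:mor Y X} = \dim {:mor Y X'}.
Proof.
move=> /iso_sym /direct_sum1 [i [p b]].
by rewrite (dim_hom_sumr _ b) big_ord1.
Qed.

Lemma dim_hom0 (X Y : C) : (forall f : mor X Y, f = 0) -> \dim {:mor X Y} = 0%N.
Proof.
move=> f0; apply/eqP; rewrite dimv_eq0 -subv0; apply/subvP => f _.
by rewrite (f0 f) mem0v.
Qed.

Lemma hom0_dim (X Y : C) (f : mor X Y) : \dim {:mor X Y} = 0%N -> f = 0.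
Proof.
move=> /eqP; rewrite dimv_eq0 => /eqP e.
by apply/eqP; rewrite -memv0 -e memvf.
Qed.

Hypothesis abC : abelian_cat C.

Lemma simple_iso (X Y : C) : isomorphic X Y -> simple_obj X -> simple_obj Y.
Proof.
case=> f [g [gf fg]] [X0 Xs]; split=> [Y0|Z h mh].
  by apply: X0; rewrite /is_zero_obj -gf -(compm1 g) Y0 compm0 comp0m.
have mgh : mono (g \oc h).
  move=> W u v; rewrite -!ocA => e; apply: mh.
  by apply: (@iso_cancell _ _ _ _ _ g) => //; exists f.
case: (Xs _ _ mgh) => [Z0|[k [kgh ghk]]]; first by left.
right; exists (k \oc g); split; first by rewrite -ocA.
rewrite -(comp1m (h \oc _)) -fg -ocA.
by rewrite (ocA g) (ocA _ k) ghk comp1m.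
Qed.

Lemma schur_iso (X Y : C) (f : mor X Y) :
  simple_obj X -> simple_obj Y -> f <> 0 -> is_iso f.
Proof.
move=> [_ Xs] [_ Ys] f0; case: abC => _ kers _ _ _.
have [K [k [fk0 kuniv]]] := kers X Y f.
have mk : mono k.
  move=> W g h e; have [|u [_ uniq]] := kuniv W (k \oc h).
    by rewrite ocA fk0 comp0m.
  by rewrite -(uniq g e) -(uniq h erefl).
case: (Xs _ _ mk) => [K0|[l [_ kl]]]; last first.
  by case: f0; rewrite -(compm1 f) -kl ocA fk0 comp0m.
have mf : mono f.
  move=> W g h e; have [|u [ku _]] := kuniv W (g - h).
    by rewrite compDr compNr e subrr.
  apply/eqP; rewrite -subr_eq0 -ku -(comp1m u) -(compm1 k).
  by rewrite K0 compm0 comp0m.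
case: (Ys _ _ mf) => [X0|//]; case: f0.
by rewrite -(compm1 f) X0 compm0.
Qed.

(** Composition with [f] acts on the nonzero space Hom(X, X) and has an eigenvalue [a], as [R[i]] is
    algebraically closed. An eigenvector is killed by [f - a], which is then not invertible, hence
    zero by [schur_iso]. *)
Lemma schur_scalar (X : C) (f : mor X X) :
  simple_obj X -> exists a : R[i], f = a *: idm X.
Proof.
move=> Xs; case: (Xs) => X0 _.
have lf : lin (fun g : mor X X => f \oc g) by move=> a u v; rewrite compDr compZr.
have [h hE] := lin_hom lf.
have dim_gt0 : (0 < dim (mor X X))%N.
  rewrite lt0n; apply/negP => /eqP d0; apply: X0; apply: hom0_dim.
  by rewrite dimvf d0.
pose M := lin1_mx (v2r \o h \o r2v).
have sz : size (char_poly M) != 1%N.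
  by rewrite size_char_poly; case: (dim _) dim_gt0.
have [a] := closed_rootP _ sz.
rewrite -eigenvalue_root_char => /eigenvalueP [v vM v0].
exists a; apply/eqP; rewrite -subr_eq0; apply/negP => /negP/eqP fa0.
have [g [gfa _]] := schur_iso Xs Xs fa0.
case/eqP: v0; apply: (can_inj r2vK); rewrite linear0.
rewrite -(comp1m (r2v v)) -gfa -ocA.
rewrite compDl compNl compZl comp1m.
have -> : f \oc r2v v = a *: r2v v.
  by rewrite -hE -linearZ -vM mul_rV_lin1 /= v2rK.
by rewrite subrr compm0.
Qed.

Lemma dim_hom_simple (X Y : C) : simple_obj X -> simple_obj Y ->
  \dim {:mor X Y} = `[< isomorphic X Y >] :> nat.
Proof.
move=> Xs Ys; case: asboolP => [XY|nXY]; last first.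
  by apply: dim_hom0 => f; apply: contrapT => /(schur_iso Xs Ys) fi; apply: nXY; exists f.
rewrite -(dim_hom_isor X XY).
have -> : fullv = <[idm X]>%VS.
  apply/eqP; rewrite eqEsubv subvf andbT; apply/subvP => f _.
  by have [a ->] := schur_scalar f Xs; apply/memvZ/memv_line.
by rewrite dim_vline; case: Xs => X0 _; case: eqP.
Qed.

Hypothesis ssC : semisimple_cat C.

(** [is_simple_system] over any finite index type, so that an option type can index the simple
    objects of [D] together with [rho]. *)
Definition simple_family (I : finType) (S : I -> C) : Prop :=
  [/\ forall a, simple_obj (S a),
      forall a b, isomorphic (S a) (S b) -> a = b
    & forall X, simple_obj X -> exists a, isomorphic X (S a)].

Lemma dim_hom_family (I : finType) (S : I -> C) a b : simple_family S ->
  \dim {:mor (S a) (S b)} = (a == b).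
Proof.
move=> [Ss Sinj _]; rewrite dim_hom_simple //; congr (nat_of_bool _).
by apply/asboolP/eqP => [/Sinj//|->]; apply: iso_refl.
Qed.

Lemma family_decomp (I : finType) (S : I -> C) X : simple_family S ->
  exists n (c : 'I_n -> I), is_direct_sum (S \o c) X.
Proof.
move=> [_ _ complete]; have [n [T [Ts [i [p b]]]]] := ssC X.
have /fin_all_exists [c cT] a : exists c, isomorphic (T a) (S c).
  exact: complete.
exists n, c; have [i' [p' b']] := biproduct_transport (T := S \o c) cT b.
by exists i', p'.
Qed.

Definition additive_fun (V : nmodType) (nu : C -> V) : Prop :=
  forall (n : nat) (S : 'I_n -> C) X, is_direct_sum S X ->
    nu X = \sum_(a < n) nu (S a).

Lemma additive_iso (V : nmodType) (nu : C -> V) X Y : additive_fun nu ->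
  isomorphic X Y -> nu X = nu Y.
Proof. by move=> add /iso_sym /direct_sum1 /add ->; rewrite big_ord1. Qed.

Lemma additive_expand (V : nmodType) (nu : C -> V) (I : finType) (S : I -> C) X :
  additive_fun nu -> simple_family S ->
  nu X = \sum_k nu (S k) *+ \dim {:mor (S k) X}.
Proof.
move=> add fam; have [n [c ds]] := family_decomp X fam.
rewrite (add _ _ _ ds) (eq_bigr (fun a => \sum_k nu (S k) *+ (k == c a))).
  rewrite exchange_big; apply: eq_bigr => k _; case: ds => i [p b].
  rewrite (dim_hom_sumr _ b) sumrMnr; congr (_ *+ _).
  by apply: eq_bigr => a _; rewrite /= dim_hom_family.
move=> a _; rewrite (bigD1 (c a)) //= big1 ?addr0 ?eqxx // => k.
by move/negPf => ->.
Qed.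

Lemma hom_simple_sym (I : finType) (S : I -> C) k X : simple_family S ->
  \dim {:mor X (S k)} = \dim {:mor (S k) X}.
Proof.
move=> fam; have [n [c [i [p b]]]] := family_decomp X fam.
rewrite (dim_hom_sumr _ b) (dim_hom_suml _ b); apply: eq_bigr => a _ /=.
by rewrite !dim_hom_family // eq_sym.
Qed.

End Semisimple.

(** * Near-integral fusion categories *)

Section Rank.
Variables (R : realType) (C : fusion_category R).

Lemma irrP : is_simple_system (@irr R C).
Proof. exact: (projT2 (cid (fusion_finite C))). Qed.

Lemma irr_family : simple_family (@irr R C).
Proof. exact: irrP. Qed.

Lemma fusion_abelian : abelian_cat C.
Proof. by case: (fusionP C) => [[]]. Qed.

Lemma fusion_semisimple : semisimple_cat C.
Proof. by case: (fusionP C) => [[]]. Qed.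

End Rank.

Section NearIntegral.
Variables (R : realType) (C : fusion_category R) (D : fusion_subcategory C).

Lemma sub_direct_sum n (S : 'I_n -> C) : (forall a, D (S a)) ->
  exists2 X, D X & is_direct_sum S X.
Proof.
move=> DS; case: (in_sub_fusion D) => [[[ds _ _ _ _] _] _ _ _].
by have [[X DX] [i [p b]]] := ds n (fun a => exist _ (S a) (DS a)); exists X => //; exists i, p.
Qed.

Lemma sub_iso X Y : isomorphic X Y -> D X -> D Y.
Proof. by case=> f [g [_ fg]]; apply: in_sub_summand fg. Qed.

Lemma sub_dual X : D X -> exists2 L, D L & is_left_dual X L.
Proof.
move=> DX; case: (in_sub_fusion D) => _ _ rig _.
by have [[[L DL] d] _] := rig (exist _ X DX); exists L.
Qed.

Lemma sub_rdual X : D X -> exists2 Y, D Y & is_left_dual Y X.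
Proof.
move=> DX; case: (in_sub_fusion D) => _ _ rig _.
by have [_ [[L DL] d]] := rig (exist _ X DX); exists L.
Qed.

Lemma left_dual_exists (X : C) : exists L, is_left_dual X L.
Proof. by case: (fusionP C) => _ _ rig _; case: (rig X). Qed.

Definition sub_irr (j : 'I_(rank (sub_fusion D))) : C := sval (irr j).

Lemma sub_irrP j : D (sub_irr j).
Proof. exact: (proj2_sig (irr j)). Qed.

(** Simplicity in [D] only tests subobjects lying in [D]. This is enough: the simple summands taken
    in [C] lie in [D] as well, and the inclusion of the first one is forced to be an isomorphism. *)
Lemma sub_irr_simple j : simple_obj (sub_irr j).
Proof.
case: (irrP (sub_fusion D)) => simp _ _; have {simp} := simp j.
rewrite /sub_irr; case: (irr j) => X DX /= [nz s].
have [n [T [Ts [i [p [pi pi0 ip]]]]]] := fusion_semisimple X.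
have DT a : D (T a) by apply: in_sub_summand (pi a) DX.
case: n T Ts i p pi pi0 ip DT => [|n] T Ts i p pi pi0 ip DT.
  by case: nz; rewrite /is_zero_obj -[LHS]ip big_ord0.
have mi : @mono _ (full_sub_linear D) (exist _ (T ord0) (DT ord0)) (exist _ X DX) (i ord0).
  move=> W g h /= e; rewrite -(comp1m g) -(comp1m h) /=.
  by rewrite -(pi ord0) -!ocA e.
case: (s _ _ mi) => [T0|[g [ig gi]]].
  by case: (Ts ord0) => + _; case.
by apply: (simple_iso _ (Ts ord0)); exists (i ord0), g.
Qed.

Variable rho : C.
Hypotheses (near_integral : (rank (sub_fusion D) + 1)%N = rank C)
  (simple_rho : simple_obj rho) (rho_notin_D : ~ D rho).

Definition near_irr (k : option 'I_(rank (sub_fusion D))) : C :=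
  if k is Some j then sub_irr j else rho.

(** Completeness is a count: choosing representatives gives an injection into the simple objects of
    [C], and near-integrality makes the two index sets equally large. *)
Lemma near_irr_family : simple_family near_irr.
Proof.
have simp k : simple_obj (near_irr k) by case: k => [j|] //; apply: sub_irr_simple.
have inj a b : isomorphic (near_irr a) (near_irr b) -> a = b.
  case: a b => [a|] [b|] //=.
  - by case: (irrP (sub_fusion D)) => _ inj _ h; congr Some; apply: inj.
  - by move=> /sub_iso h; case: rho_notin_D; apply: h; apply: sub_irrP.
  - by move=> /iso_sym/sub_iso h; case: rho_notin_D; apply: h; apply: sub_irrP.
split=> // X Xs; case: (irrP C) => irrs irrinj complete.
have /fin_all_exists [c cP] k : exists c, isomorphic (near_irr k) (irr c).
  by apply: complete.
have cinj : injective c.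
  move=> a b e; apply: inj; apply: iso_trans (cP a) _.
  by rewrite e; apply: iso_sym.
have [x Xx] := complete X Xs.
have : x \in codom c.
  apply: inj_card_onto => //.
  by rewrite card_option !card_ord -near_integral addn1.
case/codomP => k xk; exists k; apply: iso_trans Xx _.
by rewrite xk; apply: iso_sym.
Qed.

Lemma hom_sub_rho X (f : mor X rho) : D X -> f = 0.
Proof.
move=> DX; have [n [T [Ts [i [p [pi pi0 ip]]]]]] := fusion_semisimple X.
rewrite -(compm1 f) -ip comp_sumr big1 // => a _; rewrite ocA.
suff -> : f \oc i a = 0 by rewrite comp0m.
apply: contrapT => /(schur_iso (fusion_abelian C) (Ts a) simple_rho) fi.
case: rho_notin_D; apply: (@sub_iso (T a)); first by exists (f \oc i a).
exact: in_sub_summand (pi a) DX.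
Qed.

Lemma hom_rho_sub X (f : mor rho X) : D X -> f = 0.
Proof.
move=> DX; have [n [T [Ts [i [p [pi pi0 ip]]]]]] := fusion_semisimple X.
rewrite -(comp1m f) -ip comp_suml big1 // => a _; rewrite -ocA.
suff -> : p a \oc f = 0 by rewrite compm0.
apply: contrapT => /(schur_iso (fusion_abelian C) simple_rho (Ts a)) fi.
case: rho_notin_D; apply: (@sub_iso (T a)); first by apply: iso_sym; exists (p a \oc f).
exact: in_sub_summand (pi a) DX.
Qed.

Definition isotypic n (X : C) := is_direct_sum (fun _ : 'I_n => rho) X.

(** Converts the vanishing of Hom spaces, which duality can establish, into the absence of summands
    from [D]. *)
Lemma isotypic_of_hom0 X : (forall j (f : mor X (sub_irr j)), f = 0) ->
  exists n, isotypic n X.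
Proof.
move=> f0; have [n [c [i [p b]]]] := family_decomp (fusion_semisimple (C:=C)) X near_irr_family.
exists n; apply: (biproduct_transport (T := fun=> rho) _ b) => a /=.
case E: (c a) => [j|] /=; last exact: iso_refl.
have [simp _ _] := near_irr_family; have [nz _] := simp (c a); case: nz.
case: b => pi _ _; rewrite /is_zero_obj -[LHS]pi /=.
by move: (p a) (i a); rewrite /= E => pa ia; rewrite (f0 j pa) comp0m.
Qed.

Lemma isotypic_hom0 n X Y (f : mor X Y) : isotypic n X -> D Y -> f = 0.
Proof.
case=> i [p [_ _ ip]] DY; rewrite -(compm1 f) -ip comp_sumr big1 // => a _.
by rewrite ocA (hom_rho_sub (f \oc i a)) // comp0m.
Qed.

Lemma hom0_isotypic n X Y (f : mor Y X) : isotypic n X -> D Y -> f = 0.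
Proof.
case=> i [p [_ _ ip]] DY; rewrite -(comp1m f) -ip comp_suml big1 // => a _.
by rewrite -ocA (hom_sub_rho (p a \oc f)) // compm0.
Qed.

Lemma dim_isotypicr n X Y : isotypic n X -> \dim {:mor Y X} = (n * \dim {:mor Y rho})%N.
Proof. by case=> i [p b]; rewrite (dim_hom_sumr _ b) sum_nat_const card_ord. Qed.

Lemma dim_rho_rho : \dim {:mor rho rho} = 1%N.
Proof. by rewrite -[rho]/(near_irr None) (dim_hom_family (fusion_abelian C)) //; apply: near_irr_family. Qed.

End NearIntegral.

(** * Duality adjunctions as equalities of dimensions *)

Section Adjunction.
Variables (R : realType) (C : monoidal_category R).

Lemma transpose_lin (A X L B : C) coev : lin (@transpose R C A X L B coev).
Proof.
by move=> a u v; rewrite /transpose tensm_linearl !compDl !compZl.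
Qed.

Lemma untranspose_lin (A X L B : C) ev : lin (@untranspose R C A X L B ev).
Proof.
by move=> a u v; rewrite /untranspose tensm_linearl compDr compZr.
Qed.

Lemma dim_transpose (A X L B : C) : is_left_dual X L ->
  \dim {:mor (A \ox X) B} = \dim {:mor A (B \ox L)}.
Proof.
case=> ev [coev dual]; have [r [rK Kr]] := runit_iso A.
apply: (@dim_eq_bij _ _ _ _ _ (fun f => transpose coev f \oc r) (untranspose ev)).
- by move=> a u v; rewrite (transpose_lin coev a u v) compDl compZl.
- exact: untranspose_lin.
- by move=> *; apply: memvf.
- by move=> *; apply: memvf.
- by move=> f _; apply: transposeK.
move=> g _; have := untransposeK (g \oc runit A) dual rK.
by rewrite -(ocA g) Kr compm1 => ->; rewrite -ocA Kr compm1.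
Qed.

End Adjunction.

Lemma dim_ltranspose (R : realType) (C : monoidal_category R) (A X L B : C) :
  is_left_dual X L -> \dim {:mor (L \ox A) B} = \dim {:mor A (X \ox B)}.
Proof.
case=> ev [coev dual]; apply: (@dim_transpose R (rev_monoidal C) A L X B).
by exists ev, coev; apply: rev_duality.
Qed.

Section TensorSums.
Variables (R : realType) (C : monoidal_category R).

Lemma biproduct_tensl (I : finType) (S : I -> C) X i p Z :
  @biproduct R C I S X i p ->
  @biproduct R C I (fun a => S a \ox Z) (X \ox Z)
    (fun a => i a \om idm Z) (fun a => p a \om idm Z).
Proof.
case=> pi pi0 ip; split=> [a|a b ab|].
- by rewrite -tens_idr pi tensm1.
- by rewrite -tens_idr pi0 // tens0m.
by rewrite -tensm1 -ip tens_suml; apply: eq_bigr => a _; rewrite tens_idr.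
Qed.

Lemma biproduct_tensr (I : finType) (S : I -> C) X i p Z :
  @biproduct R C I S X i p ->
  @biproduct R C I (fun a => Z \ox S a) (Z \ox X)
    (fun a => idm Z \om i a) (fun a => idm Z \om p a).
Proof.
case=> pi pi0 ip; split=> [a|a b ab|].
- by rewrite -tens_idl pi tensm1.
- by rewrite -tens_idl pi0 // tensm0.
by rewrite -tensm1 -ip tens_sumr; apply: eq_bigr => a _; rewrite tens_idl.
Qed.

End TensorSums.

Lemma big_option (V : nmodType) (I : finType) (F : option I -> V) :
  \sum_k F k = F None + \sum_j F (Some j).
Proof.
rewrite (bigD1 None) //=; congr (_ + _).
rewrite (reindex_omap Some id) => [|[]//].
by apply: eq_bigl => j; rewrite eqxx.
Qed.

(** * Fusion rules of a near-integral category and its dimension function *)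

Section Multiplicities.
Variables (R : realType) (C : fusion_category R) (D : fusion_subcategory C) (rho : C).
Hypotheses (near_integral : (rank (sub_fusion D) + 1)%N = rank C)
  (simple_rho : simple_obj rho) (rho_notin_D : ~ D rho).

Let fam := near_irr_family near_integral simple_rho rho_notin_D.
Let ab := fusion_abelian C.
Let ss := @fusion_semisimple R C.

Lemma hom_rho_sym X : \dim {:mor X rho} = \dim {:mor rho X}.
Proof. exact: (hom_simple_sym ab ss None X fam). Qed.

Lemma sub_unit : D unit_obj. Proof. exact: in_sub_one. Qed.

Lemma isotypic_rho_sub X : D X -> exists n, isotypic rho n (rho \ox X).
Proof.
move=> DX; apply: (isotypic_of_hom0 near_integral simple_rho rho_notin_D) => // j f.
have [L DL dual] := sub_dual DX; apply: hom0_dim.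
rewrite (dim_transpose _ _ dual); apply: dim_hom0 => g.
by apply: (hom_rho_sub simple_rho rho_notin_D); apply: in_sub_tens => //; apply: sub_irrP.
Qed.

Lemma isotypic_sub_rho X : D X -> exists n, isotypic rho n (X \ox rho).
Proof.
move=> DX; apply: (isotypic_of_hom0 near_integral simple_rho rho_notin_D) => // j f.
have [L DL dual] := sub_rdual DX; apply: hom0_dim.
rewrite (dim_ltranspose _ _ dual); apply: dim_hom0 => g.
by apply: (hom_rho_sub simple_rho rho_notin_D); apply: in_sub_tens => //; apply: sub_irrP.
Qed.

(** A dual [L] has no map to an X in [D], as Hom(L, X) = Hom(1, rho X) and rho X is a multiple of
    rho; so L = rho^n. Comparing Hom(L rho, 1) with Hom(rho, rho) gives n * dim Hom(rho rho, 1) = 1,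
    whence n = 1. *)
Lemma left_dual_rho : exists2 L, is_left_dual rho L & isomorphic L rho.
Proof.
have [L dual] := left_dual_exists rho; exists L => //.
have [n iL] : exists n, isotypic rho n L.
  apply: (isotypic_of_hom0 near_integral simple_rho rho_notin_D) => // j f; apply: hom0_dim.
  rewrite -(@dim_hom_isol _ _ (L \ox unit_obj) L); last first.
    by exists (runit L); apply: runit_iso.
  rewrite (dim_ltranspose _ _ dual); apply: dim_hom0 => g.
  have [m im] := isotypic_rho_sub (sub_irrP j).
  exact: (hom0_isotypic simple_rho rho_notin_D g im sub_unit).
have: (n * \dim {:mor (rho \ox rho) unit_obj})%N = 1%N.
  have [i [p b]] := iL.
  rewrite -(dim_rho_rho near_integral simple_rho rho_notin_D).
  rewrite -(@dim_hom_isor _ _ (rho \ox unit_obj) rho rho); last first.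
    by exists (runit rho); apply: runit_iso.
  rewrite -(dim_ltranspose _ _ dual) (dim_hom_suml _ (biproduct_tensl rho b)).
  by rewrite sum_nat_const card_ord.
move=> /eqP; rewrite muln_eq1 => /andP [/eqP n1 _]; rewrite {}n1 in iL.
by apply: (direct_sum_iso iL); apply: direct_sum1; apply: iso_refl.
Qed.

Lemma dim_rho_right A B : \dim {:mor (A \ox rho) B} = \dim {:mor A (B \ox rho)}.
Proof.
have [L dual iL] := left_dual_rho; rewrite (dim_transpose _ _ dual).
by apply: dim_hom_isor; apply: tens_isomorphic => //; apply: iso_refl.
Qed.

Lemma dim_rho_left A B : \dim {:mor (rho \ox A) B} = \dim {:mor A (rho \ox B)}.
Proof.
have [L dual iL] := left_dual_rho; rewrite -(dim_ltranspose _ _ dual).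
apply: dim_hom_isol; apply: tens_isomorphic; last exact: iso_refl.
exact: iso_sym.
Qed.

(** On [D] this is the Frobenius-Perron dimension, read off from X rho = rho^(fdim X). It is defined
    on all of [C] so as to be additive there; its value at [rho] is kappa. *)
Definition fdim (X : C) := \dim {:mor rho (X \ox rho)}.

Lemma isotypic_dim n X : isotypic rho n X -> n = \dim {:mor rho X}.
Proof.
by move=> /dim_isotypicr ->; rewrite (dim_rho_rho near_integral) // muln1.
Qed.

Lemma isotypic_fdim X : D X -> isotypic rho (fdim X) (X \ox rho).
Proof. by move=> /isotypic_sub_rho [n iX]; rewrite /fdim -(isotypic_dim iX). Qed.

Lemma dim_sub_rhorho X : D X -> \dim {:mor X (rho \ox rho)} = fdim X.
Proof. by move=> DX; rewrite /fdim -hom_rho_sym dim_rho_right. Qed.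

Lemma dim_rho_rhosub X : D X -> \dim {:mor rho (rho \ox X)} = fdim X.
Proof. by move=> DX; rewrite -hom_rho_sym dim_rho_left dim_sub_rhorho. Qed.

Lemma fdim_add : additive_fun fdim.
Proof.
by move=> n S X [i [p b]]; rewrite /fdim (dim_hom_sumr _ (biproduct_tensl rho b)).
Qed.

Lemma fdim_tens X Y : D Y -> fdim (X \ox Y) = (fdim X * fdim Y)%N.
Proof.
move=> /isotypic_fdim [i [p b]]; rewrite {1}/fdim.
have /dim_hom_isor -> : isomorphic ((X \ox Y) \ox rho) (X \ox (Y \ox rho)).
  by exists (assoc X Y rho); apply: assoc_iso.
rewrite (dim_hom_sumr _ (biproduct_tensr X b)).
by rewrite sum_nat_const card_ord mulnC.
Qed.

Lemma fdim_unit : fdim unit_obj = 1%N.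
Proof.
rewrite /fdim -(dim_rho_rho near_integral simple_rho rho_notin_D).
by apply: dim_hom_isor; exists (lunit rho); apply: lunit_iso.
Qed.

(** Take [Y] with left dual [X]. Then Y X contains the unit, because Hom(1, Y X) = Hom(X, X) is
    nonzero. So [fdim] is positive on Y X, where it is multiplicative. *)
Lemma fdim_gt0 X : simple_obj X -> D X -> (0 < fdim X)%N.
Proof.
move=> [X0 _] DX; have [Y DY dual] := sub_rdual DX.
have: (0 < fdim (Y \ox X))%N; last by rewrite fdim_tens // muln_gt0 => /andP[].
rewrite lt0n (additive_expand ab ss _ fdim_add fam); apply/negP.
case: fam (fusionP C) => _ _ cpl [_ _ _ /cpl [k uk]].
rewrite (bigD1 k) //= addn_eq0 => /andP [+ _].
rewrite -(additive_iso fdim_add uk) fdim_unit -(dim_hom_isol _ uk).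
rewrite -(dim_ltranspose _ _ dual) (dim_hom_isol (X' := X)); last first.
  by exists (runit X); apply: runit_iso.
by rewrite natn => /eqP h; apply: X0; apply: hom0_dim.
Qed.

(* [ndim] and [fpd] are N and FPdim(rho), the positive root of d^2 = kappa d + N. *)
Definition kappa := \dim {:mor rho (rho \ox rho)}.
Definition ndim := (\sum_j fdim (sub_irr (D := D) j) ^ 2)%N.
Definition fpd : R := (kappa%:R + Num.sqrt (kappa%:R ^+ 2 + 4 * ndim%:R)) / 2.

Lemma ndim_gt0 : (0 < ndim)%N.
Proof.
case: fam (fusionP C) => simp _ cpl [_ _ _ /cpl [[j|] /= uj]].
  have fj : (0 < fdim (sub_irr j))%N.
    by apply: fdim_gt0; [apply: (simp (Some j))|apply: sub_irrP].
  by rewrite /ndim (bigD1 j) //= addn_gt0 expn_gt0 fj.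
by case: rho_notin_D; apply: (sub_iso uj); apply: sub_unit.
Qed.

Lemma fpd_sqr : fpd ^+ 2 = kappa%:R * fpd + ndim%:R.
Proof.
have h : (0 : R) <= kappa%:R ^+ 2 + 4 * ndim%:R.
  by rewrite addr_ge0 ?sqr_ge0 // mulr_ge0 ?ler0n.
have := sqr_sqrtr h; rewrite /fpd.
by set s := Num.sqrt _ => e; rewrite expr_div_n sqrrD e; field.
Qed.

Lemma fpd_gt : kappa%:R < fpd.
Proof.
rewrite /fpd ltr_pdivlMr //; set k : R := kappa%:R; set s := Num.sqrt _.
suff: k < s by lra.
rewrite /s /k.
rewrite -[X in X < _](ger0_norm (ler0n _ _)) -sqrtr_sqr ltr_sqrt.
  by rewrite ltrDl mulr_gt0 // ltr0n ndim_gt0.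
by rewrite ltr_wpDl ?sqr_ge0 // mulr_gt0 // ltr0n ndim_gt0.
Qed.

(** The combination of the additive functions [fdim] and dim Hom(rho, -) that restricts to [fdim] on
    [D] and takes the value kappa + (d - kappa) = d at [rho]. On simple objects it turns out to be
    [FPdim]. *)
Definition fpweight (X : C) : R :=
  (fdim X)%:R + (fpd - kappa%:R) * (\dim {:mor rho X})%:R.

Lemma fpweight_add : additive_fun fpweight.
Proof.
move=> n S X ds; rewrite /fpweight (fdim_add ds); case: ds => i [p b].
by rewrite (dim_hom_sumr _ b) !natr_sum mulr_sumr -big_split.
Qed.

Lemma fpweight_sub X : D X -> fpweight X = (fdim X)%:R.
Proof.
move=> DX; rewrite /fpweight dim_hom0 ?mulr0 ?addr0 // => f.
exact: (hom_rho_sub simple_rho rho_notin_D).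
Qed.

Lemma fpweight_rho : fpweight rho = fpd.
Proof.
rewrite /fpweight /fdim -/kappa (dim_rho_rho near_integral) // mulr1.
by rewrite addrC subrK.
Qed.

Lemma fpweight_isotypic n X : isotypic rho n X -> fpweight X = n%:R * fpd.
Proof.
move=> iX; rewrite (fpweight_add iX) sumr_const card_ord fpweight_rho.
by rewrite mulr_natl.
Qed.

Lemma fpweight_rhorho : fpweight (rho \ox rho) = fpd ^+ 2.
Proof.
rewrite (additive_expand ab ss _ fpweight_add fam) big_option /= fpweight_rho.
rewrite -/kappa fpd_sqr mulr_natl; congr (_ + _).
rewrite /ndim natr_sum; apply: eq_bigr => j _.
rewrite dim_sub_rhorho ?fpweight_sub; try exact: sub_irrP.
by rewrite natrX expr2 mulr_natr.
Qed.

Lemma fpweight_tens_near a b :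
  fpweight (near_irr rho a \ox near_irr rho b)
  = fpweight (near_irr (D := D) rho a) * fpweight (near_irr (D := D) rho b).
Proof.
case: b => [j|] /=.
  have Dj := sub_irrP j; rewrite (fpweight_sub Dj).
  case: a => [i|] /=.
    have Di := sub_irrP i; rewrite !fpweight_sub //; last exact: in_sub_tens.
    by rewrite fdim_tens // natrM.
  have [n iX] := isotypic_rho_sub Dj.
  rewrite (fpweight_isotypic iX) (isotypic_dim iX) dim_rho_rhosub //.
  by rewrite fpweight_rho mulrC.
rewrite fpweight_rho; case: a => [i|] /=.
  have Di := sub_irrP i.
  by rewrite (fpweight_isotypic (isotypic_fdim Di)) fpweight_sub.
by rewrite fpweight_rho fpweight_rhorho.
Qed.

Lemma near_irr_iso X : simple_obj X -> exists a, isomorphic X (near_irr (D := D) rho a).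
Proof. by case: fam => _ _; apply. Qed.

Lemma fpweight_tens X Y : simple_obj X -> simple_obj Y ->
  fpweight (X \ox Y) = fpweight X * fpweight Y.
Proof.
move=> /near_irr_iso [a Xa] /near_irr_iso [b Yb].
rewrite (additive_iso fpweight_add Xa) (additive_iso fpweight_add Yb).
rewrite -fpweight_tens_near; apply: (additive_iso fpweight_add).
exact: tens_isomorphic.
Qed.

Lemma fpd_gt0 : 0 < fpd.
Proof. by apply: le_lt_trans fpd_gt. Qed.

Lemma fpweight_near a : fpweight (near_irr (D := D) rho a) =
  if a is Some j then (fdim (sub_irr j))%:R else fpd.
Proof.
by case: a => [j|] /=; rewrite ?fpweight_rho // fpweight_sub //; apply: sub_irrP.
Qed.

Lemma fpweight_gt0 X : simple_obj X -> 0 < fpweight X.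
Proof.
move=> Xs; have [a Xa] := near_irr_iso Xs; rewrite (additive_iso fpweight_add Xa).
rewrite fpweight_near; case: a Xa => [j _|_]; last exact: fpd_gt0.
by rewrite ltr0n; apply: fdim_gt0; [apply: sub_irr_simple|apply: sub_irrP].
Qed.

End Multiplicities.

(** * Frobenius-Perron dimensions *)

Section PerronFrobenius.
Variables (R : realType) (n : nat) (A : 'M[R]_n) (v : 'I_n -> R) (l : R).
Hypotheses (A_ge0 : forall j k, 0 <= A j k) (v_gt0 : forall k, 0 < v k)
  (Av : forall j, \sum_k A j k * v k = l * v j).

(** Pair the absolute values of a left eigenvector [u] with the positive right eigenvector [v]: |x|
    sum |u_k| v_k <= sum |u_j| A_jk v_k = l sum |u_j| v_j, and the common factor is positive. *)
Lemma eigenvalue_le x : eigenvalue A x -> `|x| <= l.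
Proof.
move=> /eigenvalueP [u uA u0].
have uAk k : \sum_j u 0 j * A j k = x * u 0 k.
  by have /rowP/(_ k) := uA; rewrite !mxE.
have pos : 0 < \sum_k `|u 0 k| * v k.
  have [k uk] : exists k, u 0 k != 0.
    apply/existsP; apply: contraNT u0; rewrite negb_exists => /forallP h.
    by apply/eqP/rowP => k; rewrite mxE; apply/eqP; have := h k; rewrite negbK.
  rewrite (bigD1 k) //= ltr_pwDl //; first by rewrite mulr_gt0 // normr_gt0.
  by apply: sumr_ge0 => j _; rewrite mulr_ge0 // ltW.
rewrite -(ler_pM2r pos) !mulr_sumr.
apply: (@le_trans _ _ (\sum_k \sum_j `|u 0 j| * A j k * v k)).
  apply: ler_sum => k _; rewrite mulrA -normrM -uAk -mulr_suml ler_pM2r //.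
  apply: le_trans (ler_norm_sum _ _ _) _; apply: ler_sum => j _.
  by rewrite normrM (ger0_norm (A_ge0 j k)).
rewrite exchange_big; apply: ler_sum => j _ /=.
under eq_bigr => k _ do rewrite -mulrA.
by rewrite -mulr_sumr Av mulrCA.
Qed.

Lemma eigenvalue_positive : (0 < n)%N -> eigenvalue A l.
Proof.
move=> n_gt0.
(* [eigenvalue] refers to row vectors while [v] is a column eigenvector; comparing ranks allows the
   passage to the transpose. *)
have trE (B : 'M[R]_n) : eigenvalue B l = (\rank (B - l%:M) != n).
  by rewrite /eigenvalue /eigenspace kermx_eq0.
have -> : eigenvalue A l = eigenvalue A^T l.
  by rewrite !trE -mxrank_tr linearB /= tr_scalar_mx.
apply/eigenvalueP; exists (\row_k v k).
  apply/rowP => j; rewrite !mxE -Av; apply: eq_bigr => k _.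
  by rewrite !mxE mulrC.
apply/eqP => /rowP/(_ (Ordinal n_gt0)); rewrite !mxE => v0.
by have := v_gt0 (Ordinal n_gt0); rewrite v0 ltxx.
Qed.

Lemma sup_eigenvalue : (0 < n)%N ->
  sup [set x : R | 0 <= x /\ eigenvalue A x]%classic = l.
Proof.
move=> /eigenvalue_positive el; set E := [set x | _]%classic.
have l0 : 0 <= l by apply: le_trans (eigenvalue_le el); apply: normr_ge0.
have ubE : ubound E l by move=> x [_ /eigenvalue_le]; apply: le_trans (ler_norm x).
apply/eqP; rewrite eq_le ge_sup //=; last by exists l.
by apply: ub_le_sup; [exists l|].
Qed.

End PerronFrobenius.

Section FrobeniusPerron.
Variables (R : realType) (C : fusion_category R) (D : fusion_subcategory C) (rho : C).
Hypotheses (near_integral : (rank (sub_fusion D) + 1)%N = rank C)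
  (simple_rho : simple_obj rho) (rho_notin_D : ~ D rho).

(** Multiplicativity makes the values [nu (irr k)] a positive eigenvector of [mult_mx X] with
    eigenvalue [nu X]. The category [B] is arbitrary because both [C] and [D] are needed. *)
Lemma FPdim_additive (B : fusion_category R) (nu : B -> R) (X : B) :
  additive_fun nu -> (forall Y, simple_obj Y -> 0 < nu Y) ->
  (forall Y, simple_obj Y -> nu (X \ox Y) = nu X * nu Y) -> FPdim X = nu X.
Proof.
move=> add pos mul; rewrite /FPdim.
have [simp _ cpl] := irrP B.
apply: (@sup_eigenvalue _ _ _ (fun k => nu (irr k))).
- by move=> j k; rewrite mxE ler0n.
- by move=> k; apply: pos.
- move=> j; rewrite -mul //.
  rewrite (additive_expand (fusion_abelian B) (@fusion_semisimple _ B) _ add (irr_family B)).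
  by apply: eq_bigr => k _; rewrite mxE mulr_natl.
case: (fusionP B) => _ _ _ /cpl [k _].
exact: leq_ltn_trans (leq0n k) (ltn_ord k).
Qed.

Lemma FPdim_simple X : simple_obj X -> FPdim X = fpweight D rho X.
Proof.
move=> Xs; apply: (FPdim_additive (nu := fpweight D rho)).
- exact: fpweight_add.
- by move=> Y Ys; apply: fpweight_gt0.
by move=> Y Ys; apply: fpweight_tens.
Qed.

Lemma FPdim_sub_irr (j : 'I_(rank (sub_fusion D))) :
  FPdim (irr j) = (fdim rho (sub_irr j))%:R.
Proof.
apply: (@FPdim_additive (sub_fusion D) (fun X => (fdim rho (sval X))%:R) (irr j)).
- move=> n S X [i [p b]]; rewrite -natr_sum; congr _%:R.
  by apply: (@fdim_add R C rho); exists i, p.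
- move=> Y Ys; have [_ _ cpl] := irrP (sub_fusion D).
  have [k Yk] := cpl Y Ys; rewrite ltr0n.
  have Yk' : @isomorphic R C (sval Y) (sub_irr k).
    by case: Yk => f [g gf]; exists f, g.
  rewrite (additive_iso (@fdim_add R C rho) Yk').
  by apply: (fdim_gt0 near_integral simple_rho rho_notin_D);
    [apply: sub_irr_simple|apply: sub_irrP].
move=> Y Ys; rewrite -natrM; congr _%:R.
by apply: (fdim_tens near_integral simple_rho rho_notin_D); apply: (proj2_sig Y).
Qed.

Lemma FPdim_cat_sub : FPdim_cat (sub_fusion D) = (ndim D rho)%:R.
Proof.
rewrite /FPdim_cat /ndim natr_sum; apply: eq_bigr => j _.
by rewrite FPdim_sub_irr natrX.
Qed.

Lemma rational_nat (n : nat) : rational (n%:R : R).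
Proof. by apply/rationalP; exists n, 1%N; rewrite divr1. Qed.

Lemma rationalD (x y : R) : rational x -> rational y -> rational (x + y).
Proof. by move=> [q _ <-] [q' _ <-]; exists (q + q'); rewrite // rmorphD. Qed.

Lemma rationalM (x y : R) : rational x -> rational y -> rational (x * y).
Proof. by move=> [q _ <-] [q' _ <-]; exists (q * q'); rewrite // rmorphM. Qed.

Lemma rationalV (x : R) : rational x -> rational x^-1.
Proof. by move=> [q _ <-]; exists q^-1; rewrite // fmorphV. Qed.

Lemma rationalN (x : R) : rational x -> rational (- x).
Proof. by move=> [q _ <-]; exists (- q); rewrite // rmorphN. Qed.

(** FPdim(C) is a sum of squares of natural numbers and of d, hence rational as soon as d is. *)
Lemma irrational_fpd : irrational (FPdim_cat C) -> irrational (fpd D rho).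
Proof.
apply: contra_not => rat; rewrite /FPdim_cat.
elim/big_ind: _ => [|x y|k _]; [exact: (rational_nat 0)|exact: rationalD|].
have [simp _ _] := irrP C.
have [a ka] := near_irr_iso near_integral simple_rho rho_notin_D (simp k).
rewrite FPdim_simple // (additive_iso (@fpweight_add R C D rho) ka).
rewrite fpweight_near // expr2; apply: rationalM; case: a ka => [j|] _ //;
  exact: rational_nat.
Qed.

End FrobeniusPerron.

(** * Module functors *)

Section Modules.
Variables (R : realType) (C : fusion_category R) (D : fusion_subcategory C) (rho : C).

(* A right D-module functor from the full subcategory generated by [rho] to
   [C], recorded by the image [car] of [rho] and the action on Hom(rho X, rho). *)
Record rmod := RMod {
  car : C;
  act : forall X : C, mor (rho \ox X) rho -> mor (car \ox X) car;
  act_lin : forall X, lin (@act X);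
  act_nat : forall (X Y : C) (phi : mor (rho \ox Y) rho) (x : mor X Y),
    act (phi \oc (idm rho \om x)) = act phi \oc (idm car \om x);
  act_mul : forall (X Y : C) (phi : mor (rho \ox X) rho) (psi : mor (rho \ox Y) rho),
    D X -> D Y ->
    act (psi \oc (phi \om idm Y) \oc assoc_inv rho X Y)
    = act psi \oc (act phi \om idm Y) \oc assoc_inv car X Y;
  act_unit : exists s : mor car (car \ox unit_obj), act (runit rho) \oc s = idm car;
}.

Arguments act W {X} phi : rename.

Definition rho_mod : rmod.
Proof.
refine (@RMod rho (fun X phi => phi) _ _ _ _) => //.
by have [s [_ rs]] := runit_iso rho; exists s.
Defined.

Definition tens_mod (Z : C) (W : rmod) : rmod.
Proof.
refine (@RMod (Z \ox car W)
  (fun X phi => (idm Z \om act W phi) \oc assoc Z (car W) X) _ _ _ _).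
- by move=> X a u v; rewrite (@act_lin W X a u v) tensm_linearr compDl compZl.
- move=> X Y phi x; rewrite act_nat tens_idl -ocA.
  by rewrite -assoc_nat tensm1 ocA.
- move=> X Y phi psi DX DY; rewrite act_mul // !tens_idl tens_idr !ocA.
  rewrite (comp_reassoc (assoc_nat _ _ _)) !ocA -!(ocA (idm Z \om act W psi)).
  congr (_ \oc _); rewrite -!ocA; congr (_ \oc _).
  apply: (iso_cancelr (assoc_iso (Z \ox car W) X Y)).
  apply: (iso_cancell (f := idm Z \om assoc (car W) X Y)).
    by apply: tens_iso; [apply: id_iso|apply: assoc_iso].
  rewrite !ocA -tens_idl assoc_invK tensm1 comp1m -pentagon.
  by rewrite -!ocA assocK compm1.
have [s sK] := act_unit W; exists (assoc_inv Z (car W) unit_obj \oc (idm Z \om s)).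
by rewrite !ocA (comp_reassoc (assoc_invK _ _ _)) compm1 -tens_idl sK tensm1.
Defined.

(** Module natural transformations, given by their component at [rho]. *)
Definition is_rhom (W W' : rmod) (g : mor (car W) (car W')) : Prop :=
  forall (X : C) (phi : mor (rho \ox X) rho), D X ->
    g \oc act W phi = act W' phi \oc (g \om idm X).

Section Retract.
Variables (W : rmod) (V : C) (i : mor V (car W)) (p : mor (car W) V).
Hypotheses (pi : p \oc i = idm V) (ip_hom : is_rhom (W := W) (W' := W) (i \oc p)).

Lemma retract_stable X phi : D X ->
  i \oc p \oc act W phi \oc (i \om idm X) = act W phi \oc (i \om idm X).
Proof. by move=> DX; rewrite ip_hom // -ocA -tens_idr -(ocA i) pi compm1. Qed.

(** The image of an idempotent module endomorphism; compatibility of [i \oc p] with the action is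
    what makes the compressed action multiplicative. *)
Definition retract_mod : rmod.
Proof.
refine (@RMod V (fun X phi => p \oc act W phi \oc (i \om idm X)) _ _ _ _).
- by move=> X a u v; rewrite (@act_lin W X a u v) compDr compZr compDl compZl.
- move=> X Y phi x; rewrite act_nat -!ocA; congr (_ \oc _).
  by rewrite (tens_swap i).
- move=> X Y phi psi DX DY; rewrite act_mul //.
  rewrite -!ocA -tensm1 assoc_inv_nat !ocA -(ocA _ (i \om idm Y)).
  by rewrite -tens_idr !ocA retract_stable // tens_idr !ocA.
have D1 : D unit_obj by apply: in_sub_one.
have [s sK] := act_unit W; exists ((p \om idm unit_obj) \oc s \oc i).
rewrite !ocA -(ocA _ (i \om _)) -tens_idr -(ocA p) -ip_hom //.
by rewrite !ocA pi comp1m -(ocA p) sK compm1.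
Defined.

Lemma retract_inj_hom : is_rhom (W := retract_mod) (W' := W) i.
Proof. by move=> X phi DX /=; rewrite !ocA retract_stable. Qed.

Lemma retract_proj_hom : is_rhom (W := W) (W' := retract_mod) p.
Proof.
move=> X phi DX /=; rewrite -!ocA -tens_idr -ip_hom //.
by rewrite !ocA pi comp1m.
Qed.

End Retract.

Lemma rhom_inv (W W' : rmod) f g : g \oc f = idm _ -> f \oc g = idm _ ->
  is_rhom (W := W) (W' := W') f -> is_rhom (W := W') (W' := W) g.
Proof.
move=> gf fg fh X phi DX.
rewrite -(compm1 (g \oc _)) -tensm1 -fg tens_idr !ocA -(ocA g) -fh //.
by rewrite ocA gf comp1m.
Qed.

Lemma rhom_comp (W W' W'' : rmod) f g :
  is_rhom (W := W') (W' := W'') g -> is_rhom (W := W) (W' := W') f ->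
  is_rhom (W := W) (W' := W'') (g \oc f).
Proof. by move=> gh fh X phi DX; rewrite -ocA fh // ocA gh // tens_idr ocA. Qed.

Lemma tens_rhom (Z Z' : C) (W : rmod) (g : mor Z Z') :
  is_rhom (W := tens_mod Z W) (W' := tens_mod Z' W) (g \om idm (car W)).
Proof.
move=> X phi DX /=; rewrite ocA tens_swap -!ocA; congr (_ \oc _).
by rewrite assoc_nat tensm1.
Qed.

Lemma assoc_rhom (Y Z : C) (W : rmod) :
  is_rhom (W := tens_mod (Y \ox Z) W) (W' := tens_mod Y (tens_mod Z W))
    (assoc Y Z (car W)).
Proof.
move=> X phi DX /=; rewrite tens_idl ocA -tensm1 assoc_nat.
by rewrite -!ocA; congr (_ \oc _); rewrite !ocA pentagon.
Qed.

Lemma rhom_space_exists (W : rmod) : exists U : {vspace mor (car W) rho},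
  forall f, f \in U <-> is_rhom (W := W) (W' := rho_mod) f.
Proof.
apply: subspace_exists => [X phi DX|a u v uh vh X phi DX] /=.
  by rewrite tens0m compm0 comp0m.
rewrite compDl compZl tensm_linearl compDr compZr.
by rewrite (uh X phi DX) (vh X phi DX).
Qed.

Definition rhom_space (W : rmod) := projT1 (cid (rhom_space_exists W)).

Lemma rhom_spaceP W f : f \in rhom_space W <-> is_rhom (W := W) (W' := rho_mod) f.
Proof. exact: (projT2 (cid (rhom_space_exists W))). Qed.

Definition rhom_dim (W : rmod) : nat := \dim (rhom_space W).

Lemma rhom_dim_le W : (rhom_dim W <= \dim {:mor (car W) rho})%N.
Proof. by apply: dimvS; rewrite subvf. Qed.

Lemma rhom_dim_sum (I : finType) (M : I -> rmod) (W : rmod)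
    (i : forall a, mor (car (M a)) (car W)) (p : forall a, mor (car W) (car (M a))) :
  biproduct i p -> (forall a, is_rhom (i a)) -> (forall a, is_rhom (p a)) ->
  rhom_dim W = (\sum_a rhom_dim (M a))%N.
Proof.
move=> [pi pi0 ip] ih ph.
apply: (@dim_decomp _ I (mor (car W) rho) (fun a => mor (car (M a)) rho)
  (rhom_space W) (fun a => rhom_space (M a))
  (fun a f => f \oc i a) (fun a f => f \oc p a)).
- by move=> a c u v; rewrite compDl compZl.
- by move=> a c u v; rewrite compDl compZl.
- by move=> a u /rhom_spaceP uh; apply/rhom_spaceP; apply: rhom_comp.
- by move=> a u /rhom_spaceP uh; apply/rhom_spaceP; apply: rhom_comp.
- move=> u _; rewrite -[RHS]compm1 -ip comp_sumr.
  by apply: eq_bigr => a _; rewrite ocA.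
- by move=> a w _; rewrite -ocA pi compm1.
- by move=> a b w ab _; rewrite -ocA pi0 ?compm0 // eq_sym.
Qed.

Lemma rhom_dim_add (W : rmod) : additive_fun (fun Z => rhom_dim (tens_mod Z W)).
Proof.
move=> n S X [i [p b]].
by apply: (rhom_dim_sum (M := fun a => tens_mod (S a) W) (W := tens_mod X W)
    (biproduct_tensl (car W) b)) => a; apply: tens_rhom.
Qed.

Lemma rhom_dim_assoc (Y Z : C) (W : rmod) :
  rhom_dim (tens_mod (Y \ox Z) W) = rhom_dim (tens_mod Y (tens_mod Z W)).
Proof.
set M := tens_mod Y (tens_mod Z W).
have := @rhom_dim_sum 'I_1 (fun=> M) (tens_mod (Y \ox Z) W)
  (fun=> assoc_inv Y Z (car W)) (fun=> assoc Y Z (car W)).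
rewrite big_ord1; apply.
- split=> [_|a b|]; first exact: assoc_invK.
    by rewrite !ord1.
  by rewrite big_ord1 assocK.
- move=> _; apply: (rhom_inv _ _ (@assoc_rhom Y Z W)); first exact: assocK.
  exact: assoc_invK.
by move=> _; apply: assoc_rhom.
Qed.

End Modules.

(** * Module maps rho Q -> rho for a module Q carried by [D] *)

Section SubModules.
Variables (R : realType) (C : fusion_category R) (D : fusion_subcategory C) (rho : C).
Hypotheses (near_integral : (rank (sub_fusion D) + 1)%N = rank C)
  (simple_rho : simple_obj rho) (rho_notin_D : ~ D rho).

(** By Schur's lemma Hom(rho 1, rho) is the line through [runit rho]; its coordinate [sc] makes the
    pairing of [rhom_dim_sub] scalar valued. *)
Lemma rho_scalar : exists sc : mor (rho \ox unit_obj) rho -> R[i]^o,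
  lin sc /\ forall g, g = sc g *: runit rho.
Proof.
have [r [rK Kr]] := runit_iso rho.
have ex g : exists a : R[i], g = a *: runit rho.
  have [a e] := schur_scalar (fusion_abelian C) (g \oc r) simple_rho.
  by exists a; rewrite -(compm1 g) -rK ocA e compZl comp1m.
exists (fun g => projT1 (cid (ex g))).
have scP g : g = projT1 (cid (ex g)) *: runit rho := projT2 (cid (ex g)).
split=> // a u v; apply/eqP; rewrite -subr_eq0; apply/negP => /negP ne.
have r0 : runit rho != 0.
  apply/eqP => r0; case: simple_rho => + _; case.
  by rewrite /is_zero_obj -Kr r0 comp0m.
have /eqP := scP (a *: u + v); rewrite {1}(scP u) {1}(scP v) scalerA -scalerDl.
rewrite -subr_eq0 -scalerBl scaler_eq0 (negPf r0) orbF subr_eq0 eq_sym => /eqP e.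
by move: ne; rewrite e subrr eqxx.
Qed.

Section Pairing.
Variables (Q : rmod D rho) (DQ : D (car Q)).

Lemma rhom_tens_eq (chi : mor (rho \ox car Q) rho) X (phi : mor (rho \ox X) rho) :
  is_rhom (W := tens_mod rho Q) (W' := rho_mod D rho) chi -> D X ->
  chi \oc (idm rho \om act Q phi)
  = phi \oc (chi \om idm X) \oc assoc_inv rho (car Q) X.
Proof.
move=> ch DX; have /= <- := ch X phi DX.
by rewrite ocA (comp_reassoc (assoc_invK _ _ _)) compm1.
Qed.

Lemma rhom_tens_of_eq (chi : mor (rho \ox car Q) rho) :
  (forall X (phi : mor (rho \ox X) rho), D X ->
    chi \oc (idm rho \om act Q phi)
    = phi \oc (chi \om idm X) \oc assoc_inv rho (car Q) X) ->
  is_rhom (W := tens_mod rho Q) (W' := rho_mod D rho) chi.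
Proof.
move=> ch X phi DX /=; rewrite ocA ch //.
by rewrite (comp_reassoc (assocK _ _ _)) compm1.
Qed.

(** The transposes take values in rho L, a multiple of [rho] since [L] lies in [D], and are
    therefore detected by maps rho L -> rho. *)
Lemma transpose_separates (T L : C) ev coev (f g : mor (rho \ox T) rho) :
  @is_duality R C T L ev coev -> D L ->
  (forall psi : mor (rho \ox L) rho,
    psi \oc transpose coev f = psi \oc transpose coev g) -> f = g.
Proof.
move=> dual DL e; have [r [rK Kr]] := runit_iso rho.
have [n [i [p [_ _ ip]]]] := isotypic_rho_sub near_integral simple_rho rho_notin_D DL.
rewrite -(transposeK f dual Kr) -(transposeK g dual Kr); congr (untranspose ev (_ \oc r)).
rewrite -[LHS]comp1m -[RHS]comp1m -ip !comp_suml; apply: eq_bigr => a _.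
by rewrite -!ocA e.
Qed.

(** Test the transpose of [chi] against psi : rho L -> rho. Module linearity turns the result into
    [chi] applied to [act Q psi \oc coev], which is one of the maps [q]. *)
Lemma rhom_tens_nondeg chi :
  is_rhom (W := tens_mod rho Q) (W' := rho_mod D rho) chi ->
  (forall q : mor unit_obj (car Q), chi \oc (idm rho \om q) = 0) -> chi = 0.
Proof.
move=> ch ch0; have [L DL [ev [coev dual]]] := sub_dual DQ.
apply: (transpose_separates dual DL) => psi.
rewrite /transpose !ocA -(rhom_tens_eq _ ch) // -ocA -tens_idl ch0.
by rewrite tens0m compm0 !comp0m.
Qed.

(** The nondegeneracy argument run backwards: it prescribes psi composed with the transpose of [chi]
    as the scalar [xi (act Q psi \oc coev)], which determines [chi]. It remains to see that this
    [chi] is a module map. *)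
Lemma rhom_tens_represents (xi : 'Hom(mor unit_obj (car Q), R[i]^o)) :
  exists2 chi, is_rhom (W := tens_mod rho Q) (W' := rho_mod D rho) chi &
    forall q, chi \oc (idm rho \om q) = xi q *: runit rho.
Proof.
have [L DL [ev [coev dual]]] := sub_dual DQ.
have [n [i [p [_ _ ip]]]] := isotypic_rho_sub near_integral simple_rho rho_notin_D DL.
have [r [rK Kr]] := runit_iso rho.
(* The map to rho L whose component along each projection [p a] is the prescribed scalar. *)
pose iota := \sum_a xi (act Q (p a) \oc coev) *: (i a \oc runit rho).
pose chi := untranspose ev (iota \oc r).
have chiT : transpose coev chi = iota by apply: untransposeK.
  clearbody chi.
(* The prescription, imposed on the [p a] only, extends to all [phi] and [x]: universality of [coev]
   reduces to Y = L, and there [phi'] is a linear combination of the [p a]. *)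
have key Y (phi : mor (rho \ox Y) rho) (x : mor unit_obj (car Q \ox Y)) :
    phi \oc (chi \om idm Y) \oc assoc_inv rho (car Q) Y \oc (idm rho \om x)
    = xi (act Q phi \oc x) *: runit rho.
  have [x' <-] := coev_universal x dual.
  rewrite tens_idl ocA (comp_reassoc (assoc_inv_nat _ _ _)) !ocA tensm1.
  rewrite (comp_reassoc (tens_swap _ _)) !ocA -act_nat.
  move: (phi \oc (idm rho \om x')) => phi'.
  rewrite -!ocA (ocA (chi \om _)).
  rewrite -/(transpose coev chi) chiT comp_sumr.
  have phiE a : exists c : R[i], phi' \oc i a = c *: idm rho.
    exact: (schur_scalar (fusion_abelian C)).
  have /fin_all_exists [c cE] := phiE.
  have -> : act Q phi' = \sum_a c a *: act Q (p a).
    have [g gE] := lin_hom (act_lin Q (X := L)).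
    rewrite -gE -(compm1 phi') -ip comp_sumr linear_sum; apply: eq_bigr => a _.
    by rewrite ocA cE compZl comp1m linearZ /= gE.
  rewrite comp_suml linear_sum scaler_suml; apply: eq_bigr => a _.
  by rewrite compZr compZl linearZ ocA cE compZl comp1m scalerA mulrC.
have ch : is_rhom (W := tens_mod rho Q) (W' := rho_mod D rho) chi.
  apply: rhom_tens_of_eq => X phi DX.
  have DT : D (car Q \ox X) by apply: in_sub_tens.
  (* Both sides are evaluated by [key], once at [psi] and once at [psi] composed with [phi];
     [act_mul] identifies the two values. *)
  have [L' DL' [ev' [coev' dual']]] := sub_dual DT.
  apply: (transpose_separates dual' DL') => psi.
  have := key _ (psi \oc (phi \om idm L') \oc assoc_inv rho X L')
    (assoc (car Q) X L' \oc coev').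
  rewrite act_mul // !ocA (comp_reassoc (assocK _ _ _)) compm1.
  rewrite /transpose !tens_idr !ocA.
  rewrite -(tensm1 X L') (comp_reassoc (assoc_inv_nat _ _ _)) !ocA.
  rewrite tens_idl !ocA => k2.
  rewrite (comp_reassoc (esym (assoc_inv_nat _ _ _))) !ocA.
  rewrite (comp_reassoc (esym (tens_idl _ _ _))) key !ocA -k2.
  congr (_ \oc _); rewrite -!ocA; congr (_ \oc (_ \oc (_ \oc _))).
  rewrite (ocA (assoc_inv _ _ _)) -pentagon_inv -!ocA -tens_idl assocK.
  by rewrite tensm1 compm1.
(* The section [s] writes [q] as [act Q (runit rho)] composed with [s \oc q], the form that [key]
   evaluates. *)
exists chi => // q; have [s sK] := act_unit Q.
rewrite -{1}(comp1m q) -sK -ocA tens_idl ocA (rhom_tens_eq _ ch).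
  by rewrite key ocA sK comp1m.
exact: in_sub_one.
Qed.

(** The duality behind p(Q) = d m: module maps rho Q -> rho pair perfectly with Hom(1, Q) through
    composition. *)
Lemma rhom_dim_sub : rhom_dim (tens_mod rho Q) = \dim {:mor unit_obj (car Q)}.
Proof.
have [sc [scl scE]] := rho_scalar.
apply: (dim_pairing (B := fun chi q => sc (chi \oc (idm rho \om q)))).
- by move=> q a u v; rewrite compDl compZl scl.
- by move=> chi a u v; rewrite tensm_linearr compDr compZr scl.
- move=> chi ch ch0.
  have {}ch := iffLR (rhom_spaceP (W := tens_mod rho Q) chi) ch.
  apply: rhom_tens_nondeg => // q.
  by rewrite (scE (chi \oc _)) ch0 scale0r.
move=> xi; have [chi ch chE] := rhom_tens_represents xi.
exists chi; first exact: (iffRL (rhom_spaceP (W := tens_mod rho Q) chi)).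
move=> q; have := scE (chi \oc (idm rho \om q)); rewrite {1}chE => /eqP.
rewrite -subr_eq0 -scalerBl scaler_eq0 subr_eq0 => /orP [/eqP //|/eqP r0].
have [r [_ Kr]] := runit_iso rho; case: simple_rho => + _; case.
by rewrite /is_zero_obj -Kr r0 comp0m.
Qed.

Lemma rhom_dim_sub_sub X : D X -> rhom_dim (tens_mod X Q) = 0%N.
Proof.
move=> DX; apply/eqP; rewrite -leqn0; apply: leq_trans (rhom_dim_le _) _.
rewrite dim_hom0 // => f; apply: (hom_sub_rho simple_rho rho_notin_D).
exact: in_sub_tens.
Qed.

End Pairing.
End SubModules.

(** * Splitting a module into its [D]-part and its [rho]-isotypic part *)

Lemma split_off (R : realType) (C : linear_category R) n (S : 'I_n -> C) (X Y : C)
    i p (P : pred 'I_n) :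
  @biproduct R C _ S X i p -> is_direct_sum (fun b : 'I_#|P| => S (enum_val b)) Y ->
  exists (j : mor Y X) (q : mor X Y),
    q \oc j = idm Y /\ j \oc q = \sum_(a | P a) (i a \oc p a).
Proof.
move=> [pi pi0 ip] [i' [p' [pi' pi0' ip']]].
exists (\sum_b (i (enum_val b) \oc p' b)), (\sum_b (i' b \oc p (enum_val b))).
split.
  rewrite comp_suml -[RHS]ip'; apply: eq_bigr => b _.
  rewrite comp_sumr (bigD1 b) //= big1 => [|c cb].
    by rewrite addr0 ocA (comp_reassoc (pi _)) compm1.
  rewrite ocA (comp_reassoc (pi0 _ _ _)) ?compm0 ?comp0m //.
  by rewrite (inj_eq enum_val_inj) eq_sym.
rewrite comp_suml (eq_bigl (fun a => a \in P)) // (big_enum_val (fun a => i a \oc p a)).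
apply: eq_bigr => b _.
rewrite comp_sumr (bigD1 b) //= big1 => [|c cb].
  by rewrite addr0 ocA (comp_reassoc (pi' _)) compm1.
by rewrite ocA (comp_reassoc (pi0' _ _ _)) ?compm0 ?comp0m // eq_sym.
Qed.

(** If [e] were positive, the powers of d / k would be bounded, against Bernoulli's inequality; for
    k = 0 the exponent 1 decides. *)
Lemma geometric_le0 (R : realType) (e C k d : R) : 0 <= k -> k < d ->
  (forall n, e * d ^+ n <= C * k ^+ n) -> e <= 0.
Proof.
rewrite le_eqVlt => /orP [/eqP <- d0 /(_ 1%N)|k0 kd le].
  by rewrite !expr1 mulr0 pmulr_lle0.
rewrite leNgt; apply/negP => e0; pose x := d / k - 1.
have x0 : 0 < x by rewrite subr_gt0 ltr_pdivlMr // mul1r.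
have bern n : 1 + n%:R * x <= (d / k) ^+ n.
  have -> : d / k = 1 + x by rewrite /x addrC subrK.
  elim: n => [|n IHn]; first by rewrite mul0r addr0 expr0.
  rewrite exprS; have n0 : (0 : R) <= n%:R by apply: ler0n.
  apply: (@le_trans _ _ ((1 + x) * (1 + n%:R * x))).
    by rewrite -natr1; nra.
  by apply: ler_wpM2l; [rewrite addr_ge0 // ltW|].
clearbody x; have := archi_boundP (divr_ge0 (normr_ge0 C) (ltW (mulr_gt0 e0 x0))).
set n := Num.bound _; rewrite ltr_pdivrMr ?mulr_gt0 // ltNge => /negP; apply.
apply: le_trans (ler_norm C).
have kn : 0 < k ^+ n by apply: exprn_gt0.
have := le n; rewrite -ler_pdivrMr // -mulrA -expr_div_n; apply: le_trans.
apply: le_trans (_ : e * (1 + n%:R * x) <= _); last by rewrite ler_pM2l.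
by rewrite mulrDr mulr1 mulrCA lerDr ltW.
Qed.

Section Splitting.
Variables (R : realType) (C : fusion_category R) (D : fusion_subcategory C) (rho : C).
Hypotheses (near_integral : (rank (sub_fusion D) + 1)%N = rank C)
  (simple_rho : simple_obj rho) (rho_notin_D : ~ D rho).

Lemma split_obj (X : C) : exists (Q V : C) (iQ : mor Q X) (pQ : mor X Q)
    (iV : mor V X) (pV : mor X V) (m : nat),
  [/\ D Q, isotypic rho m V, pQ \oc iQ = idm Q, pV \oc iV = idm V
    & (iQ \oc pQ) + (iV \oc pV) = idm X].
Proof.
have fam := near_irr_family near_integral simple_rho rho_notin_D.
have [n [c [i [p b]]]] := family_decomp (@fusion_semisimple R C) X fam.
pose P : pred 'I_n := fun a => c a != None.
have [Q DQ dsQ] : exists2 Q, D Q &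
    is_direct_sum (fun b : 'I_#|P| => near_irr rho (c (enum_val b))) Q.
  apply: sub_direct_sum => b'; have := enum_valP b'; rewrite unfold_in /P.
  by case: (c _) => // j _; apply: sub_irrP.
have [ds _ _ _ _] := fusion_abelian C.
have [V dsV] := ds _ (fun b : 'I_#|predC P| => near_irr rho (c (enum_val b))).
have [iQ [pQ [pi eQ]]] := split_off b dsQ.
have [iV [pV [pi' eV]]] := split_off b dsV.
exists Q, V, iQ, pQ, iV, pV, #|predC P|; split=> //.
  case: dsV => i' [p' b']; apply: (biproduct_transport (T := fun=> rho) _ b') => a.
  have := enum_valP a; rewrite unfold_in /= /P negbK => /eqP ->.
  exact: iso_refl.
by rewrite eQ eV; case: b => _ _ <-; rewrite [RHS](bigID P).
Qed.

Lemma tens_rhom_r (Z : C) (W W' : rmod D rho) g :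
  is_rhom (W := W) (W' := W') g ->
  is_rhom (W := tens_mod Z W) (W' := tens_mod Z W') (idm Z \om g).
Proof.
move=> gh X phi DX /=; rewrite ocA -tens_idl gh // tens_idl -!ocA.
by rewrite assoc_nat.
Qed.

(** For X in [D] all maps V X -> Q and Q X -> V vanish, V being isotypic. So the two projectors
    commute with the action, and their images are modules. *)
Lemma split_mod (W : rmod D rho) : exists (Q V : rmod D rho) (m : nat),
  [/\ D (car Q), isotypic rho m (car V),
      forall Z, rhom_dim (tens_mod Z W)
        = (rhom_dim (tens_mod Z Q) + rhom_dim (tens_mod Z V))%N
    & forall Y, \dim {:mor Y (car W)}
        = (\dim {:mor Y (car Q)} + \dim {:mor Y (car V)})%N].
Proof.
have [Q [V [iQ [pQ [iV [pV [m [DQ mV pQi pVi eQV]]]]]]]] := split_obj (car W).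
have QV0 (f : mor V Q) : f = 0 by apply: (isotypic_hom0 simple_rho rho_notin_D f mV).
have VQ0 (f : mor Q V) : f = 0 by apply: (hom0_isotypic simple_rho rho_notin_D f mV).
have VXQ0 X (f : mor (V \ox X) Q) : D X -> f = 0.
  move=> DX; have [L DL dual] := sub_dual DX; apply: hom0_dim.
  rewrite (dim_transpose _ _ dual); apply: dim_hom0 => g.
  by apply: (isotypic_hom0 simple_rho rho_notin_D g mV); apply: in_sub_tens.
have QXV0 X (f : mor (Q \ox X) V) : D X -> f = 0.
  move=> DX; apply: (hom0_isotypic simple_rho rho_notin_D f mV).
  exact: in_sub_tens.
have actQ X (phi : mor (rho \ox X) rho) : D X -> pV \oc act W phi \oc (iQ \om idm X) = 0.
  by move=> DX; apply: QXV0.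
have actV X (phi : mor (rho \ox X) rho) : D X -> pQ \oc act W phi \oc (iV \om idm X) = 0.
  by move=> DX; apply: VXQ0.
have hQ : is_rhom (W := W) (W' := W) (iQ \oc pQ).
  move=> X phi DX.
  (* Both sides equal the action compressed to Q: the cross terms vanish by [actV] on the left and
     by [actQ] on the right. *)
  transitivity (iQ \oc pQ \oc act W phi \oc ((iQ \oc pQ) \om idm X)).
    rewrite -[LHS]compm1 -tensm1 -eQV tensDl compDr (tens_idr _ iV) !ocA.
    have -> : iQ \oc pQ \oc act W phi \oc (iV \om idm X) = 0.
      by rewrite -!ocA (ocA pQ) actV // compm0.
    by rewrite comp0m addr0.
  rewrite -[RHS]comp1m -eQV compDl (tens_idr _ iQ) !ocA.
  have -> : iV \oc pV \oc act W phi \oc (iQ \om idm X) = 0.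
    by rewrite -!ocA (ocA pV) actQ // compm0.
  by rewrite comp0m addr0.
have hV : is_rhom (W := W) (W' := W) (iV \oc pV).
  have -> : iV \oc pV = idm _ - (iQ \oc pQ) by rewrite -eQV addrC addKr.
  move=> X phi DX; rewrite compDl compNl comp1m hQ //.
  have -> : - (iQ \oc pQ) = (-1) *: (iQ \oc pQ) by rewrite scaleN1r.
  by rewrite tensDl tensZl compDr compZr tensm1 compm1 scaleN1r.
pose MQ := retract_mod pQi hQ; pose MV := retract_mod pVi hV.
pose M b := if b then MQ else MV.
pose i b : mor (car (M b)) (car W) :=
  match b return mor (car (M b)) (car W) with true => iQ | false => iV end.
pose p b : mor (car W) (car (M b)) :=
  match b return mor (car W) (car (M b)) with true => pQ | false => pV end.
have bM : biproduct i p.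
  split; first by case.
    by move=> [] [] //= _.
  by rewrite big_bool.
have ih b : is_rhom (i b).
  by case: b; apply: retract_inj_hom.
have ph b : is_rhom (p b).
  by case: b; apply: retract_proj_hom.
exists MQ, MV, m; split=> // [Z|Y]; last first.
  by rewrite (dim_hom_sumr _ bM) big_bool.
rewrite (rhom_dim_sum (M := fun b => tens_mod Z (M b)) (W := tens_mod Z W)
  (biproduct_tensr Z bM)) ?big_bool //.
- by move=> b; apply: (@tens_rhom_r Z (M b) W).
- by move=> b; apply: (@tens_rhom_r Z W (M b)).
Qed.

End Splitting.

(** * Divisibility *)

Lemma natmulnE (a b : nat) : a *+ b = (a * b)%N.
Proof. by rewrite -mulr_natr natn. Qed.

Section Divisibility.
Variables (R : realType) (C : fusion_category R) (D : fusion_subcategory C) (rho : C).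
Hypotheses (near_integral : (rank (sub_fusion D) + 1)%N = rank C)
  (simple_rho : simple_obj rho) (rho_notin_D : ~ D rho).

Let fam := near_irr_family near_integral simple_rho rho_notin_D.
Let d := fpd D rho.
Let k : R := (kappa rho)%:R.

(* FPdim of the internal Hom from [W] to [rho_mod]. *)
Definition ihom_dim (W : rmod D rho) : R :=
  \sum_j (fdim rho (sub_irr (D := D) j))%:R * (rhom_dim (tens_mod (sub_irr j) W))%:R
  + d * (rhom_dim (tens_mod rho W))%:R.

(** The internal Hom from rho W is the one from W tensored with the dual of rho. On multiplicities
    this comes down to the fusion rules for X rho and rho rho, with d^2 = kappa d + N. *)
Lemma ihom_dim_tens W : ihom_dim (tens_mod rho W) = d * ihom_dim W.
Proof.
have sub j : rhom_dim (tens_mod (sub_irr (D := D) j) (tens_mod rho W))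
    = (fdim rho (sub_irr j) * rhom_dim (tens_mod rho W))%N.
  have := isotypic_fdim near_integral simple_rho rho_notin_D (sub_irrP (D := D) j).
  by rewrite -rhom_dim_assoc => /(rhom_dim_add W) ->; rewrite sum_nat_const card_ord.
have rr : (rhom_dim (tens_mod rho (tens_mod rho W)))%:R
    = k * (rhom_dim (tens_mod rho W))%:R + \sum_j (fdim rho (sub_irr (D := D) j))%:R
        * (rhom_dim (tens_mod (sub_irr j) W))%:R :> R.
  rewrite -rhom_dim_assoc (additive_expand (fusion_abelian C)
    (@fusion_semisimple R C) _ (rhom_dim_add W) fam) big_option /=.
  rewrite natrD natr_sum natmulnE natrM [k * _]mulrC; congr (_ + _).
  apply: eq_bigr => j _; rewrite (dim_sub_rhorho near_integral) //; last exact: sub_irrP.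
  by rewrite natmulnE natrM mulrC.
rewrite /ihom_dim rr; under eq_bigr => j _ do rewrite sub natrM mulrA.
rewrite -mulr_suml; set r : R := (rhom_dim _)%:R; set s : R := \sum_j _ * (rhom_dim _)%:R.
have -> : \sum_j (fdim rho (sub_irr (D := D) j))%:R * (fdim rho (sub_irr j))%:R
    = (ndim D rho)%:R :> R.
  by rewrite /ndim natr_sum; apply: eq_bigr => j _; rewrite natrX expr2.
have := fpd_sqr D rho; rewrite -/d -/k => e.
by ring: e.
Qed.

Lemma ihom_dim_sub W : D (car W) ->
  ihom_dim W = d * (\dim {:mor unit_obj (car W)})%:R.
Proof.
move=> DW; rewrite /ihom_dim big1 => [|j _].
  by rewrite add0r (rhom_dim_sub near_integral).
by rewrite (rhom_dim_sub_sub simple_rho rho_notin_D DW (sub_irrP j)) mulr0.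
Qed.

Lemma ihom_dim_ge0 W : 0 <= ihom_dim W.
Proof.
apply: addr_ge0; first by apply: sumr_ge0 => j _; rewrite mulr_ge0 ?ler0n.
apply: mulr_ge0; last exact: ler0n.
exact: ltW (fpd_gt0 near_integral simple_rho rho_notin_D).
Qed.

(** Forgetting module structures only enlarges spaces of maps, and Hom(Z rho^m, rho) is m copies of
    Hom(Z rho, rho). *)
Lemma ihom_dim_le : exists2 B : R, 0 <= B &
  forall m W, isotypic rho m (car W) -> ihom_dim W <= B * m%:R.
Proof.
pose b Z : R := (\dim {:mor (Z \ox rho) rho})%:R.
exists (\sum_j (fdim rho (sub_irr (D := D) j))%:R * b (sub_irr j) + d * b rho).
  have d0 := fpd_gt0 near_integral simple_rho rho_notin_D.
  apply: addr_ge0; first by apply: sumr_ge0 => j _; rewrite mulr_ge0 ?ler0n.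
  by rewrite mulr_ge0 ?ler0n ?ltW.
move=> m W [i [p bW]].
have le Z : (rhom_dim (tens_mod Z W))%:R <= b Z * m%:R.
  rewrite -natrM ler_nat; apply: leq_trans (rhom_dim_le _) _.
  by rewrite (dim_hom_suml _ (biproduct_tensr Z bW)) sum_nat_const card_ord mulnC.
have d0 := fpd_gt0 near_integral simple_rho rho_notin_D.
rewrite /ihom_dim mulrDl mulr_suml lerD //.
  by apply: ler_sum => j _; rewrite -mulrA ler_wpM2l ?ler0n.
rewrite -mulrA ler_wpM2l //; first exact: ltW.
Qed.

(** The slope that solves the recursion: d lambda = d + kappa lambda. *)
Let lambda := d / (d - k).

(* The error [|p(V) - lambda m|] is multiplied by [d] when passing from V to the
   rho-isotypic part of rho V, but it is at most proportional to [kappa m] there. *)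
Lemma ihom_dim_isotypic m W : isotypic rho m (car W) -> ihom_dim W = lambda * m%:R.
Proof.
have kd : k < d := fpd_gt near_integral simple_rho rho_notin_D.
have k0 : 0 <= k := ler0n _ _.
have d0 : 0 < d := le_lt_trans k0 kd.
have lE : lambda * (d - k) = d by rewrite /lambda divfK // gt_eqF // subr_gt0.
have l0 : 0 < lambda by rewrite divr_gt0 // subr_gt0.
have [B B0 leB] := ihom_dim_le.
have bound n m' V : isotypic rho m' (car V) ->
    `|ihom_dim V - lambda * m'%:R| * d ^+ n <= (B + lambda) * m'%:R * k ^+ n.
  elim: n m' V => [|n IHn] m' V iV.
    rewrite !expr0 !mulr1 mulrDl; apply: le_trans (ler_normB _ _) _.
    rewrite (ger0_norm (ihom_dim_ge0 _)) ger0_norm; last by rewrite mulr_ge0 // ltW.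
    by apply: lerD => //; apply: leB.
  have [Q [V' [m2 [DQ iV' hs ds]]]] :=
    split_mod near_integral simple_rho rho_notin_D (tens_mod rho V).
  have [i [p bV]] := iV.
  (* Hom(rho, -) sees only the isotypic part of rho V, and Hom(1, -) only the part in [D]; rho V
     consists of [m'] copies of rho rho. *)
  have m2E : m2 = (m' * kappa rho)%N.
    rewrite (isotypic_dim near_integral simple_rho rho_notin_D iV').
    have := ds rho; rewrite [X in _ = (X + _)%N]dim_hom0 => [|f]; last first.
      exact: (hom_rho_sub simple_rho rho_notin_D).
    by rewrite add0n => <-; rewrite (dim_hom_sumr _ (biproduct_tensr rho bV))
      sum_nat_const card_ord.
  have Q1 : \dim {:mor unit_obj (car Q)} = m'.
    have := ds unit_obj; rewrite [X in _ = (_ + X)%N]dim_hom0 => [|f]; last first.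
      apply: (hom0_isotypic simple_rho rho_notin_D f iV'); exact: in_sub_one.
    rewrite addn0 => <-; rewrite (dim_hom_sumr _ (biproduct_tensr rho bV)).
    rewrite sum_nat_const card_ord (dim_sub_rhorho near_integral) //; last exact: in_sub_one.
    by rewrite (fdim_unit near_integral) // muln1.
  have step : d * ihom_dim V = d * m'%:R + ihom_dim V'.
    rewrite -ihom_dim_tens -Q1 -ihom_dim_sub // /ihom_dim !hs natrD mulrDr.
    under eq_bigr => j _ do rewrite hs natrD mulrDr.
    by rewrite big_split /=; ring.
  have IH := IHn _ _ iV'; rewrite m2E natrM -/k in IH.
  have e : d * (ihom_dim V - lambda * m'%:R) = ihom_dim V' - lambda * (m'%:R * k).
    by rewrite mulrBr step -[X in X * m'%:R]lE; ring.
  rewrite exprS mulrA -(mulrC d) -{1}(gtr0_norm d0) -normrM e.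
  by apply: le_trans IH _; rewrite exprS !mulrA.
move=> iW; have := geometric_le0 k0 kd (fun n => bound n m W iW).
by rewrite normr_le0 subr_eq0 => /eqP.
Qed.

Lemma ndim_dvd_kappa : irrational d -> (ndim D rho %| kappa rho)%N.
Proof.
move=> irr_d.
have kd : k < d := fpd_gt near_integral simple_rho rho_notin_D.
have d0 : 0 < d := fpd_gt0 near_integral simple_rho rho_notin_D.
have := fpd_sqr D rho; rewrite -/d -/k; set N := ndim D rho => dE.
have iso1 : isotypic rho 1 (car (rho_mod D rho)).
  by apply: direct_sum1; apply: iso_refl.
have := ihom_dim_isotypic iso1; rewrite mulr1 /ihom_dim.
set r := rhom_dim (tens_mod rho _).
pose s := (\sum_j fdim rho (sub_irr (D := D) j)
            * rhom_dim (tens_mod (sub_irr j) (rho_mod D rho)))%N.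
have -> : \sum_j (fdim rho (sub_irr (D := D) j))%:R
    * (rhom_dim (tens_mod (sub_irr j) (rho_mod D rho)))%:R = s%:R :> R.
  by rewrite natr_sum; apply: eq_bigr => j _; rewrite natrM.
have dk : d - k != 0 by rewrite gt_eqF // subr_gt0.
move=> e; have {e} e : (s%:R + d * r%:R) * (d - k) = d by rewrite e /lambda divfK.
have Nd : N%:R = d * (d - k) by rewrite mulrBr -expr2 dE; ring.
(* Multiplying s + d r = d / (d - k) by N = d (d - k) and reducing d^2 leaves a linear equation in d
   with integer coefficients. *)
have e2 : (N%:R * r%:R - k) * d = N%:R - N%:R * s%:R.
  have : d * ((s%:R + d * r%:R) * (d - k)) = d ^+ 2 by rewrite e expr2.
  rewrite mulrCA -Nd dE => e3.
  have : N%:R * s%:R + N%:R * r%:R * d = k * d + N%:R by rewrite -e3; ring.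
  by move=> e4; rewrite mulrBl -[N%:R * r%:R * d](addKr (N%:R * s%:R)) e4; ring.
have [e0|ne0] := eqVneq (N%:R * r%:R - k) 0.
  move: e0 => /eqP; rewrite subr_eq0 -natrM eqr_nat => /eqP <-.
  exact: dvdn_mulr.
case: irr_d; have -> : d = (N%:R - N%:R * s%:R) / (N%:R * r%:R - k).
  by rewrite -e2 mulrAC divff // mul1r.
rewrite -!natrM; apply: rationalM; [|apply: rationalV];
  by apply: rationalD; [|apply: rationalN]; apply: rational_nat.
Qed.

End Divisibility.

Theorem lemma4p3 (R : realType) (C : fusion_category R)
    (D : fusion_subcategory C) (rho : C)
    (near_integral : (rank (sub_fusion D) + 1)%N = rank C)
    (simple_rho : simple_obj rho) (rho_notin_D : ~ D rho)
    (irrational_dim : irrational (FPdim_cat C)) :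
  exists N : nat, FPdim_cat (sub_fusion D) = N%:R /\
    (N %| \dim {:mor rho (rho \ox rho)})%N.
Proof.
exists (ndim D rho); split; first exact: (FPdim_cat_sub near_integral).
apply: ndim_dvd_kappa => //.
exact: (irrational_fpd near_integral simple_rho rho_notin_D irrational_dim).
Qed.
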